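(* For $j\in\{0,1,2\}$ let $R_j=\frac{d\nu_j}{d\nu}$ and $Q_j=\frac{1}{25}+\frac{12}{25}R_j$. If $u$ is a finite-energy function on $SG$ for which the energy Laplacian $\Delta_\nu u$ is defined, then for each $j\in\{0,1,2\}$ the energy Laplacian of $u\circ F_j$ is defined and $$\Delta_\nu(u\circ F_j)=Q_j\,\big((\Delta_\nu u)\circ F_j\big)\qquad \nu\text{-almost everywhere}.$$
   Context: Let $q_0,q_1,q_2$ be the vertices of an equilateral triangle in $\mathbb{R}^2$, $F_i(x)=\frac12(x+q_i)$, and let $SG$ (the Sierpinski gasket) be the unique nonempty compact set with $SG=\bigcup_{i=0}^2F_i(SG)$. For a finite word $w=(w_1,\dots,w_m)$ in $\{0,1,2\}$ put $|w|=m$, $F_w=F_{w_1}\circ\cdots\circ F_{w_m}$; the sets $F_wSG$ are called cells. The boundary of $SG$ is $\{q_0,q_1,q_2\}$. For continuous real functions $u,v$ on $SG$ put $\mathcal{E}_m(u,v)=\left(\frac53\right)^m\sum_{|w|=m}\sum_{i<j}(u(F_wq_i)-u(F_wq_j))(v(F_wq_i)-v(F_wq_j))$, $\mathcal{E}(u,v)=\lim_m\mathcal{E}_m(u,v)$, defined when $\mathcal{E}(u,u),\mathcal{E}(v,v)<\infty$ ($u$, $v$ have finite energy). A function $h$ is harmonic if $\mathcal{E}_m(h,h)$ is independent of $m$; harmonic functions are uniquely determined by arbitrary values at $q_0,q_1,q_2$. Let $h_i$ be the harmonic function with $h_i(q_j)=\delta_{ij}$. Let $\nu_i$ be the finite Borel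 measure on $SG$ with $\nu_i(F_wSG)=\left(\frac53\right)^{|w|}\mathcal{E}(h_i\circ F_w,h_i\circ F_w)$ for all $w$. The Kusuoka measure is $\nu=\nu_0+\nu_1+\nu_2$; all $\nu_i$ are absolutely continuous with respect to $\nu$, and $\frac{d\nu_i}{d\nu}$ is the Radon-Nikodym derivative. The energy Laplacian $\Delta_\nu u$ of a finite-energy function $u$ is the function (in $L^1(\nu)$), if it exists, satisfying $-\mathcal{E}(u,v)=\int_{SG}(\Delta_\nu u)\,v\,d\nu$ for every finite-energy $v$ vanishing at $q_0,q_1,q_2$. *)

(* Defs.v *)
From HB Require Import structures.
From mathcomp Require Import all_boot all_order all_algebra.
From mathcomp Require Import all_classical all_reals all_analysis.

Set Implicit Arguments.
Unset Strict Implicit.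
Unset Printing Implicit Defensive.

Import Order.TTheory GRing.Theory Num.Theory.
Import numFieldNormedType.Exports.

Local Open Scope classical_set_scope.
Local Open Scope ring_scope.

(* The carrier is R * R; the measurable sets are those generated by the open
   sets. A Borel measure on SG is encoded as a measure on the plane that
   vanishes outside SG, and a function on SG as a function on the plane of which
   only the values on SG matter. *)
Notation borel_plane R := (g_sigma_algebraType (@open (R * R)%type)).

Section gasket.
Context {R : realType}.
Local Notation plane := (R * R)%type.
Implicit Types (q : 'I_3 -> plane) (SG : set plane) (u v h f : plane -> R).

(* The norm of the library on R * R is the sup norm, hence the explicit
   Euclidean distance. *)
Definition edist (x y : plane) : R :=
  Num.sqrt ((x.1 - y.1) ^+ 2 + (x.2 - y.2) ^+ 2).

Definition equilateral q : Prop :=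
  exists2 l : R, 0 < l & forall i j, i != j -> edist (q i) (q j) = l.

Definition F q (i : 'I_3) (x : plane) : plane :=
  ((x.1 + (q i).1) / 2, (x.2 + (q i).2) / 2).

(* F_w = F_{w_1} o ... o F_{w_m}: the first letter is applied last. *)
Definition Fw q (w : seq 'I_3) (x : plane) : plane := foldr (F q) x w.

Definition sierpinski_gasket q SG : Prop :=
  [/\ SG !=set0, compact SG & SG = \bigcup_(i in [set: 'I_3]) (F q i @` SG)].

Definition energy_level q (m : nat) u v : R :=
  (5 / 3) ^+ m * \sum_(w : m.-tuple 'I_3)
    \sum_(i < 3) \sum_(j < 3 | (i < j)%N)
      (u (Fw q w (q i)) - u (Fw q w (q j))) *
      (v (Fw q w (q i)) - v (Fw q w (q j))).

(* The limit of a divergent sequence is a junk value; it is only used for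
   functions of finite energy, for which the sequence converges. *)
Definition energy q u v : R := limn (fun m => energy_level q m u v).

(* The sequence is nondecreasing in m, so its convergence in R says that
   its limit is finite. *)
Definition finite_energy q SG u : Prop :=
  {within SG, continuous u} /\ cvgn (fun m => energy_level q m u u).

Definition sg_harmonic q SG h : Prop :=
  {within SG, continuous h} /\
  forall m n, energy_level q m h h = energy_level q n h h.

Definition energy_measure q SG h (mu : set plane -> \bar R) : Prop :=
  mu (~` SG) = 0%E /\
  forall w : seq 'I_3, mu (Fw q w @` SG) =
    ((5 / 3) ^+ size w * energy q (h \o Fw q w) (h \o Fw q w))%:E.

Section kusuoka.
Variable nu_ : 'I_3 -> {finite_measure set (borel_plane R) -> \bar R}.
Local Open Scope ereal_scope.

Definition kusuoka (A : set (borel_plane R)) : \bar R := \sum_(i < 3) nu_ i A.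

Let kusuoka0 : kusuoka set0 = 0.
Proof. by rewrite /kusuoka big1. Qed.

Let kusuoka_ge0 A : 0 <= kusuoka A.
Proof. by apply: sume_ge0. Qed.

Let kusuokaE (A : set (borel_plane R)) :
  kusuoka A = msum (fun k => nu_ (inord k)) 3 A.
Proof. by apply: eq_bigr => i _; rewrite inord_val. Qed.

Let kusuoka_sigma_additive : semi_sigma_additive kusuoka.
Proof.
move=> B mB tB mUB; rewrite kusuokaE.
under eq_fun do under eq_bigr do rewrite kusuokaE.
exact: measure_semi_sigma_additive.
Qed.

HB.instance Definition _ := isMeasure.Build _ _ _ kusuoka
  kusuoka0 kusuoka_ge0 kusuoka_sigma_additive.

Let kusuoka_finite : fin_num_fun kusuoka.
Proof. by move=> A mA; apply/sum_fin_numP => i _ _; exact: fin_num_measure. Qed.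

HB.instance Definition _ := @Measure_isFinite.Build _ _ _ kusuoka kusuoka_finite.

End kusuoka.

(* The Radon-Nikodym derivative of the library takes values in \bar R, and so do
   RN and Q; absolute continuity makes these values finite. *)
Definition RN (nu_ : 'I_3 -> {finite_measure set (borel_plane R) -> \bar R})
    (j : 'I_3) : borel_plane R -> \bar R :=
  Radon_Nikodym (charge_of_finite_measure (nu_ j)) (kusuoka nu_).

Definition Q (nu_ : 'I_3 -> {finite_measure set (borel_plane R) -> \bar R})
    (j : 'I_3) (x : borel_plane R) : \bar R :=
  ((1 / 25)%:E + (12 / 25)%:E * RN nu_ j x)%E.


(* f is (a version of) the energy Laplacian of u with respect to nu; as an
   element of L^1 it is determined up to nu-almost everywhere equality. *)
Definition is_energy_laplacian q SG
    (nu : {measure set (borel_plane R) -> \bar R}) u f : Prop :=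
  [/\ finite_energy q SG u,
      nu.-integrable SG (EFin \o f) &
      forall v, finite_energy q SG v -> (forall i, v (q i) = 0) ->
        (- energy q u v)%:E = (\int[nu]_(x in SG) (f x * v x)%:E)%E].

End gasket.

(* Main.v *)
Require Import Defs.
From HB Require Import structures.
From mathcomp Require Import all_boot all_order all_algebra.
From mathcomp Require Import all_classical all_reals all_analysis.
From mathcomp Require Import measurable_realfun ring lra.
Import Order.TTheory GRing.Theory Num.Theory.
Import numFieldNormedType.Exports.
Local Open Scope classical_set_scope.
Local Open Scope ring_scope.

Set Implicit Arguments.
Unset Strict Implicit.
Unset Printing Implicit Defensive.

(** The cell [F_j SG] is a copy of [SG], on which energies are multiplied by [5/3]:
    if a function [v] vanishing at the corners is copied into [F_j SG] and extended
    by zero, the result [v'] is again a continuous function of finite energy that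
    vanishes at the corners, and the energy of [u] against [v'] is [5/3] of the
    energy of [u \o F_j] against [v] ([energy_transplant]). Testing the Laplacian
    [f] of [u] against [v'] gives an integral over [F_j SG] with respect to the
    Kusuoka measure [nu]. Everything then rests on how [nu] changes under [F_j]:
      [nu (F_j A) = 1/15 nu A + 4/5 nu_j A]  ([kusuoka_selfsimilar]),
    that is, [5/3 Q_j] is the density of [A |-> nu (F_j A)]. The factors [5/3]
    cancel, and [Q_j (f \o F_j)] is a Laplacian of [u \o F_j]
    ([laplacian_cell_exists]).

    On a cell the self-similarity is an identity between quadratic forms. A function
    whose energies do not depend on the level must follow the 2/5-2/5-1/5 extension
    rule in each cell, because the energy of level 1 exceeds that of level 0 by a
    definite quadratic form in the deviations from this rule ([energy_level1_gain],
    [flat_step]). So [h_i \o F_j] is an explicit combination of [h_0, h_1, h_2], and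
    as these add up to a constant, the energies of the three functions [h_i \o F_j]
    add up to [1/25] of the sum of those of the [h_i] plus [12/25] of that of [h_j]
    ([kusuoka_cell_energy]). Cells determine measures: a closed set is the decreasing
    limit of unions of cells, and the overlaps of cells of one level are null because
    the measures of these cells add up to the measure of [SG]
    ([cell_measure_unique], [nu_overlap]).

    It remains to see that the Laplacian is unique almost everywhere
    ([laplacian_unique]). The difference [d] of two Laplacians is orthogonal to all
    test functions. The functions [1 - (h_0^n + h_1^n + h_2^n)] are test functions
    and tend to [1] off the set where some [h_i] equals [1]. This set is null, since
    [F_i] maps [[h_i = 1]] onto a set that contains it, while multiplying measures by
    at most [13/15] ([peak_null]). Copying these functions into a cell, the integral
    of [d] over that cell vanishes ([annihilator_cell]), and [d] is zero since
    signed measures are determined by cells as well. *)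

(** * Discrete energies *)

Local Notation c0 := (ord0 : 'I_3).
Local Notation c1 := (lift ord0 ord0 : 'I_3).
Local Notation c2 := (lift ord0 (lift ord0 ord0) : 'I_3).

Lemma ord3_ind (P : 'I_3 -> Prop) : P c0 -> P c1 -> P c2 -> forall i, P i.
Proof.
move=> P0 P1 P2 [[|[|[|//]]] h].
- by rewrite (_ : Ordinal h = c0)//; apply: val_inj.
- by rewrite (_ : Ordinal h = c1)//; apply: val_inj.
- by rewrite (_ : Ordinal h = c2)//; apply: val_inj.
Qed.

Lemma sum3E (V : nmodType) (g : 'I_3 -> V) :
  \sum_(i < 3) g i = g c0 + g c1 + g c2.
Proof. by rewrite !big_ord_recl big_ord0 addr0 addrA. Qed.

Lemma sum_tuple_cons (V : nmodType) (T : finType) m (g : seq T -> V) :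
  \sum_(w : m.+1.-tuple T) g w = \sum_(k : T) \sum_(w : m.-tuple T) g (k :: w).
Proof.
rewrite pair_big /=.
rewrite (reindex (fun p : T * m.-tuple T => [tuple of p.1 :: p.2])) //=.
exists (fun w : m.+1.-tuple T => (thead w, [tuple of behead w])).
- by move=> [k w] _ /=; congr pair; apply: val_inj.
- by move=> w _ /=; rewrite [RHS]tuple_eta.
Qed.

Section discrete_energy.
Context {R : realType} (q : 'I_3 -> R * R).
Implicit Types (a b : 'I_3 -> R) (u v : R * R -> R).

Definition corner_energy a b : R :=
  \sum_(i < 3) \sum_(j < 3 | (i < j)%N) (a i - a j) * (b i - b j).

Lemma corner_energyE a b : corner_energy a b =
  (a c0 - a c1) * (b c0 - b c1) + (a c0 - a c2) * (b c0 - b c2) +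
  (a c1 - a c2) * (b c1 - b c2).
Proof.
rewrite /corner_energy sum3E !(big_mkcond (fun j : 'I_3 => _ < _)%N) /=.
by rewrite !sum3E /= /bump /= !(addr0, add0r).
Qed.

Lemma energy_levelE m u v : energy_level q m u v = (5 / 3) ^+ m *
  \sum_(w : m.-tuple 'I_3)
    corner_energy (u \o Fw q w \o q) (v \o Fw q w \o q).
Proof. by []. Qed.

Lemma energy_level0 u v : energy_level q 0 u v = corner_energy (u \o q) (v \o q).
Proof.
rewrite energy_levelE expr0 mul1r.
by rewrite (big_pred1 [tuple]) // => w; rewrite [w]tuple0 /= eqxx.
Qed.

Lemma energy_levelS m u v : energy_level q m.+1 u v =
  5 / 3 * \sum_(k < 3) energy_level q m (u \o F q k) (v \o F q k).
Proof.
rewrite energy_levelE (sum_tuple_cons _ (fun w =>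
  corner_energy (u \o Fw q w \o q) (v \o Fw q w \o q))) /=.
under [in RHS]eq_bigr do rewrite energy_levelE.
by rewrite -mulr_sumr exprS mulrA.
Qed.

Lemma F_corner i : F q i (q i) = q i.
Proof. by rewrite /F; case: (q i) => x y /=; congr pair; field. Qed.

Lemma F_cornerC i j : F q i (q j) = F q j (q i).
Proof. by rewrite /F addrC [X in (_, X / _)]addrC. Qed.

Lemma Fw_cat w1 w2 x : Fw q (w1 ++ w2) x = Fw q w1 (Fw q w2 x).
Proof. by rewrite /Fw foldr_cat. Qed.

Lemma Fw_cons k w x : Fw q (k :: w) x = F q k (Fw q w x).
Proof. by []. Qed.

(** The harmonic extension rule: the midpoint of two corners receives [2/5] of the
    value at each of them and [1/5] of the value at the third corner. *)
Definition harmonic_step (a : 'I_3 -> R) (k p : 'I_3) : R :=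
  if k == p then a k else (a k + a p + \sum_(l < 3) a l) / 5.

(** The harmonic extension minimizes the energy of level 1 among all functions with
    given corner values, so no term of first order in the deviations [d] is left:
    what remains is the energy of [d] itself on the graph of the six points. *)
Lemma energy_level1_gain u :
  let d k p := u (F q k (q p)) - harmonic_step (u \o q) k p in
  energy_level q 1 u u - energy_level q 0 u u =
  5 / 3 * (2 * (d c0 c1 ^+ 2 + d c0 c2 ^+ 2 + d c1 c2 ^+ 2) +
    (d c0 c1 - d c0 c2) ^+ 2 + (d c0 c1 - d c1 c2) ^+ 2 +
    (d c0 c2 - d c1 c2) ^+ 2).
Proof.
rewrite /= energy_levelS sum3E !energy_level0 !corner_energyE /=.
rewrite !F_corner (F_cornerC c1 c0) (F_cornerC c2 c0) (F_cornerC c2 c1).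
by rewrite /harmonic_step /= !sum3E /=; field.
Qed.

Lemma energy_level01 u : energy_level q 0 u u <= energy_level q 1 u u.
Proof.
rewrite -subr_ge0 energy_level1_gain /=.
by repeat (exact: sqr_ge0 || apply: addr_ge0 || apply: mulr_ge0 ||
           exact: divr_ge0 || exact: ler0n).
Qed.

Lemma energy_level_ndS m u : energy_level q m u u <= energy_level q m.+1 u u.
Proof.
elim: m u => [|m IH] u; first exact: energy_level01.
by rewrite energy_levelS (energy_levelS m.+1) ler_pM2l // ler_sum.
Qed.

Lemma energy_level_nd u :
  {homo (fun m => energy_level q m u u) : m n / (m <= n)%N >-> m <= n}.
Proof. by apply: homo_leq => // [? ? ?|m]; [apply: le_trans|apply: energy_level_ndS]. Qed.

Lemma energy_level_ge0 m u : 0 <= energy_level q m u u.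
Proof.
rewrite energy_levelE mulr_ge0 ?exprn_ge0 ?divr_ge0 // sumr_ge0 // => w _.
by rewrite corner_energyE -!expr2 !addr_ge0 ?sqr_ge0.
Qed.

(** ** Energy-flat functions *)

(** The energy part of [sg_harmonic]: it only sees the values at the points
    [F_w q_i]. *)
Definition flat u : Prop := forall m, energy_level q m u u = energy_level q 0 u u.

(** Energies never decrease from one level to the next inside a cell, so that a
    constant total forces constancy in each cell. *)
Lemma flat_F u k : flat u -> flat (u \o F q k).
Proof.
move=> fu m; apply/eqP; rewrite eq_sym.
have le0 i : energy_level q 0 (u \o F q i) (u \o F q i) <=
             energy_level q m (u \o F q i) (u \o F q i).
  exact: energy_level_nd.
have := fu m.+1; rewrite -(fu 1%N) !energy_levelS => /(mulfI _) E.
have {}E := E _; move: k; apply/forallP; apply: contraT => /forallPn /= [k nk].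
have := E (ltac:(by [])) => /eqP; rewrite gt_eqF //.
rewrite (bigD1 k) //= [ltRHS](bigD1 k) //=; apply: ltr_leD.
  by rewrite lt_neqAle nk le0.
by apply: ler_sum.
Qed.

Lemma flat_Fw u w : flat u -> flat (u \o Fw q w).
Proof.
elim: w u => [//|k w IH] u fu.
exact: (IH _ (flat_F k fu)).
Qed.

Lemma flat_step u k p : flat u -> u (F q k (q p)) = harmonic_step (u \o q) k p.
Proof.
move=> fu.
have [-> |kp] := eqVneq k p; first by rewrite /harmonic_step eqxx F_corner.
have := energy_level1_gain u; rewrite /= (fu 1%N) subrr => /esym/eqP.
rewrite mulf_eq0 mulf_eq0 invr_eq0 !pnatr_eq0 /=.
set A := u _ - _; set B := u _ - _; set C := u _ - _ => /= E0.
have [A0 B0 C0] : [/\ A = 0, B = 0 & C = 0].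
  have := sqr_ge0 A; have := sqr_ge0 B; have := sqr_ge0 C.
  have := sqr_ge0 (A - B); have := sqr_ge0 (A - C); have := sqr_ge0 (B - C).
  move/eqP : E0 => E0 ? ? ? ? ? ?.
  by split; apply/eqP; rewrite -sqrf_eq0; apply/eqP; lra.
have sym i j : harmonic_step (u \o q) i j = harmonic_step (u \o q) j i.
  by rewrite /harmonic_step eq_sym; case: eqP => [->//|_]; rewrite (addrC (_ i)).
move/subr0_eq : A0 => A0; move/subr0_eq : B0 => B0; move/subr0_eq : C0 => C0.
elim/ord3_ind: k kp; elim/ord3_ind: p => // _.
- by rewrite F_cornerC sym.
- by rewrite F_cornerC sym.
- by rewrite F_cornerC sym.
Qed.

(** A flat function is at the points [F_w q_i] the combination of the [h_l] with
    its corner values as coefficients: both sides obey the same linear rule. *)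
Lemma flat_expand (h : 'I_3 -> R * R -> R) u w p :
  (forall l, flat (h l)) -> (forall l i, h l (q i) = (l == i)%:R) -> flat u ->
  u (Fw q w (q p)) = \sum_(l < 3) u (q l) * h l (Fw q w (q p)).
Proof.
move=> fh hb fu.
elim: w u h fh hb fu => [|k w IH] u h fh hb fu.
  rewrite /= (bigD1 p) //= hb eqxx mulr1 big1 ?addr0 // => l lp.
  by rewrite hb (negbTE lp) mulr0.
transitivity (\sum_(l < 3) (u \o F q k) (q l) * h l (Fw q w (q p))).
  exact: IH fh hb (flat_F k fu).
rewrite [RHS](eq_bigr (fun l =>
    \sum_(i < 3) u (q l) * (h l (F q k (q i)) * h i (Fw q w (q p))))); last first.
  by move=> l _; rewrite -mulr_sumr; congr (_ * _); exact: IH fh hb (flat_F k (fh l)).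
rewrite exchange_big /=; apply: eq_bigr => i _.
rewrite (flat_step k i fu) /harmonic_step /=.
under [RHS]eq_bigr do rewrite (flat_step k i (fh _)) mulrA.
rewrite -mulr_suml; congr (_ * _); rewrite /harmonic_step /= !sum3E !hb.
by elim/ord3_ind: k; elim/ord3_ind: i => /=; by field.
Qed.

Lemma flat_ge0 u w p : flat u -> (forall l, 0 <= u (q l)) -> 0 <= u (Fw q w (q p)).
Proof.
elim: w u => [u _ u0|k w IH u fu u0]; first exact: u0.
apply: (IH (u \o F q k)); first exact: flat_F.
move=> l /=; rewrite flat_step // /harmonic_step /= sum3E.
by case: eqP => // _; rewrite divr_ge0 // !addr_ge0.
Qed.

End discrete_energy.

(** * Functions of finite energy *)

Section finite_energies.
Context {R : realType} (q : 'I_3 -> R * R).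
Implicit Types (u v : R * R -> R).

Lemma cvgn_energyP u : cvgn (fun m => energy_level q m u u) <->
  exists M, forall m, energy_level q m u u <= M.
Proof.
split=> [cu|[M uM]].
  exists (limn (fun m => energy_level q m u u)) => m.
  by apply: nondecreasing_cvgn_le => //; exact: energy_level_nd.
apply: nondecreasing_is_cvgn; first exact: energy_level_nd.
by exists M => _ [m _ <-].
Qed.

Lemma energy_level_dominated (I : finType) (g : I -> R * R -> R) v (C : R) m :
  (forall w i j, (v (Fw q w (q i)) - v (Fw q w (q j))) ^+ 2 <=
     C * \sum_(l : I) (g l (Fw q w (q i)) - g l (Fw q w (q j))) ^+ 2) ->
  energy_level q m v v <= C * \sum_(l : I) energy_level q m (g l) (g l).
Proof.
move=> vg; under eq_bigr do rewrite energy_levelE.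
rewrite energy_levelE -mulr_sumr mulrCA ler_wpM2l ?exprn_ge0 ?divr_ge0 //.
rewrite [X in _ <= C * X]exchange_big mulr_sumr ler_sum // => w _.
rewrite corner_energyE -!expr2.
under eq_bigr do rewrite corner_energyE -!expr2.
rewrite !big_split /= !mulrDr; do 2 (apply: lerD; last exact: vg).
exact: vg.
Qed.

Lemma energy_level_polar m u v : energy_level q m u v =
  (energy_level q m (u \+ v) (u \+ v) - energy_level q m u u -
   energy_level q m v v) / 2.
Proof.
rewrite !energy_levelE -!mulrBr -mulrA; congr (_ * _).
rewrite -!sumrB mulr_suml; apply: eq_bigr => w _.
by rewrite !corner_energyE /=; field.
Qed.

Lemma cvgn_energyD u v : cvgn (fun m => energy_level q m u u) ->
  cvgn (fun m => energy_level q m v v) ->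
  cvgn (fun m => energy_level q m (u \+ v) (u \+ v)).
Proof.
move=> /cvgn_energyP[M uM] /cvgn_energyP[N vN]; apply/cvgn_energyP.
exists (2 * (M + N)) => m.
pose g (b : bool) := if b then u else v.
apply: (@le_trans _ _ (2 * \sum_b energy_level q m (g b) (g b))).
  apply: energy_level_dominated => w i j; rewrite big_bool /=.
  set a := u _; set b := u _; set c := v _; set d := v _.
  by have := sqr_ge0 ((a - b) - (c - d)); rewrite !expr2; lra.
by rewrite big_bool ler_wpM2l // lerD.
Qed.

Lemma cvgn_energy u v : cvgn (fun m => energy_level q m u u) ->
  cvgn (fun m => energy_level q m v v) -> cvgn (fun m => energy_level q m u v).
Proof.
move=> cu cv; under eq_fun do rewrite energy_level_polar.
by apply: is_cvgMl; apply: is_cvgB => //; apply: is_cvgB => //; exact: cvgn_energyD.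
Qed.

Lemma cvgn_energy_F u k : cvgn (fun m => energy_level q m u u) ->
  cvgn (fun m => energy_level q m (u \o F q k) (u \o F q k)).
Proof.
move=> /cvgn_energyP[M uM]; apply/cvgn_energyP; exists (3 / 5 * M) => m.
have := uM m.+1; rewrite energy_levelS (bigD1 k) //=.
have : 0 <= \sum_(i < 3 | i != k) energy_level q m (u \o F q i) (u \o F q i).
  by apply: sumr_ge0 => i _; exact: energy_level_ge0.
lra.
Qed.

Lemma energy_flat u : flat q u -> energy q u u = energy_level q 0 u u.
Proof.
move=> fu; rewrite /energy (_ : (fun _ => _) = cst (energy_level q 0 u u)).
  by rewrite lim_cst.
exact/funext.
Qed.

(** ** Transplanting a function into one cell *)

(** Energies only see the points [F_w q_i], so the relation between a function and
    its copy in one cell is required at those points only. *)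
Definition transplant_of (j : 'I_3) v v0 : Prop := forall k w i,
  v (F q k (Fw q w (q i))) = if k == j then v0 (Fw q w (q i)) else 0.

Lemma energy_level_transplant j v v0 u m : transplant_of j v v0 ->
  energy_level q m.+1 u v = 5 / 3 * energy_level q m (u \o F q j) v0.
Proof.
move=> tv; rewrite energy_levelS (bigD1 j) //= big1 ?addr0.
  rewrite !energy_levelE; do 2 congr (_ * _); apply: eq_bigr => w _.
  by rewrite !corner_energyE /= !tv eqxx.
move=> k kj; rewrite energy_levelE big1 ?mulr0 // => w _.
by rewrite corner_energyE /= !tv (negbTE kj) !subrr !mulr0 !addr0.
Qed.

Lemma energy_level_transplant2 j v v0 m : transplant_of j v v0 ->
  energy_level q m.+1 v v = 5 / 3 * energy_level q m v0 v0.
Proof.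
move=> tv; rewrite (energy_level_transplant _ _ tv).
rewrite !energy_levelE; do 2 congr (_ * _); apply: eq_bigr => w _.
by rewrite !corner_energyE /= !tv eqxx.
Qed.

Lemma cvgn_energy_transplant j v v0 : transplant_of j v v0 ->
  cvgn (fun m => energy_level q m v0 v0) -> cvgn (fun m => energy_level q m v v).
Proof.
move=> tv /cvgn_energyP[M vM]; apply/cvgn_energyP; exists (5 / 3 * M) => m.
apply: (le_trans (energy_level_ndS q m v)).
by rewrite (energy_level_transplant2 _ tv) ler_pM2l ?divr_gt0.
Qed.

Lemma energy_transplant j v v0 u : transplant_of j v v0 ->
  cvgn (fun m => energy_level q m u u) -> cvgn (fun m => energy_level q m v0 v0) ->
  energy q u v = 5 / 3 * energy q (u \o F q j) v0.
Proof.
move=> tv cu cv0; rewrite /energy.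
have cv := cvgn_energy_transplant tv cv0.
have cm := cvgn_energy (cvgn_energy_F (k:=j) cu) cv0.
have ul : (fun m => energy_level q m.+1 u v) @ \oo --> limn (fun m => energy_level q m u v).
  by have := cvgn_energy cu cv; rewrite -(cvg_shiftS (fun m => energy_level q m u v)).
have mul_l : (fun m => 5 / 3 * energy_level q m (u \o F q j) v0) @ \oo -->
    5 / 3 * limn (fun m => energy_level q m (u \o F q j) v0).
  by apply: cvgM cm; exact: cvg_cst.
apply: (cvg_unique _ ul) => //; move: mul_l; apply: cvg_trans; apply: near_eq_cvg.
by apply: nearW => m; rewrite (energy_level_transplant _ _ tv).
Qed.

End finite_energies.

(** * The harmonic basis *)

Section harmonic_basis.
Context {R : realType} (q : 'I_3 -> R * R) (h : 'I_3 -> R * R -> R).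
Hypotheses (fh : forall l, flat q (h l)) (hb : forall l i, h l (q i) = (l == i)%:R).

Lemma flat_cst c : flat q (cst c).
Proof.
move=> m; rewrite energy_level0 energy_levelE corner_energyE /= !subrr !mulr0 !addr0.
by rewrite big1 ?mulr0 // => w _; rewrite corner_energyE /= !subrr !mulr0 !addr0.
Qed.

Lemma flat_sum1 w p : \sum_(l < 3) h l (Fw q w (q p)) = 1.
Proof.
have := flat_expand w p fh hb (flat_cst 1) => /= ->.
by under [RHS]eq_bigr do rewrite mul1r.
Qed.

Lemma harmonic_basis01 l w p : 0 <= h l (Fw q w (q p)) <= 1.
Proof.
have h0 i : 0 <= h i (Fw q w (q p)).
  by apply: flat_ge0 => // k; rewrite hb ler0n.
by rewrite h0 -(flat_sum1 w p) (bigD1 l) //= lerDl sumr_ge0.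
Qed.

Lemma flat_cells u m : flat q u -> energy_level q 0 u u =
  (5 / 3) ^+ m * \sum_(w : m.-tuple 'I_3) energy_level q 0 (u \o Fw q w) (u \o Fw q w).
Proof.
move=> fu; rewrite -(fu m) energy_levelE; congr (_ * _).
by apply: eq_bigr => w _; rewrite energy_level0.
Qed.

(** Writing [h_i \o F_j] in the basis [h_0, h_1, h_2], whose sum is constant, makes
    this an identity between quadratic forms in the corner values on one cell. *)
Lemma kusuoka_cell_energy j w :
  \sum_(i < 3) energy_level q 0 (h i \o Fw q (j :: w)) (h i \o Fw q (j :: w)) =
  1 / 25 * \sum_(i < 3) energy_level q 0 (h i \o Fw q w) (h i \o Fw q w) +
  12 / 25 * energy_level q 0 (h j \o Fw q w) (h j \o Fw q w).
Proof.
have E i p : h i (Fw q (j :: w) (q p)) =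
    \sum_(l < 3) harmonic_step (h i \o q) j l * h l (Fw q w (q p)).
  have := flat_expand w p fh hb (flat_F j (fh i)) => /= ->.
  by apply: eq_bigr => l _; rewrite (flat_step _ _ (fh i)).
have S p : h c0 (Fw q w (q p)) = 1 - h c1 (Fw q w (q p)) - h c2 (Fw q w (q p)).
  by have := flat_sum1 w p; rewrite sum3E => <-; ring.
under eq_bigr do rewrite energy_level0 corner_energyE /= -/(Fw q (j :: w) _) !E.
under [in RHS]eq_bigr do rewrite energy_level0 corner_energyE /=.
rewrite energy_level0 corner_energyE /= !sum3E /harmonic_step /= !sum3E /= !hb.
by elim/ord3_ind: j {E} => /=; rewrite !S; field.
Qed.

Lemma sqr_subXX_le (a b : R) n : 0 <= a <= 1 -> 0 <= b <= 1 ->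
  (a ^+ n - b ^+ n) ^+ 2 <= n%:R ^+ 2 * (a - b) ^+ 2.
Proof.
move=> /andP[a0 a1] /andP[b0 b1]; rewrite subrXX exprMn mulrC.
rewrite ler_wpM2r ?sqr_ge0 // lerXn2r ?nnegrE ?ler0n //.
  by apply: sumr_ge0 => i _; rewrite mulr_ge0 ?exprn_ge0.
rewrite -[n in leRHS]card_ord -sum1_card natr_sum ler_sum // => i _.
by rewrite mulr_ile1 ?exprn_ge0 ?exprn_ile1.
Qed.

(** Powers of the [h_l] decrease to the indicators of [h_l = 1], while their sum
    is [1] at the corners: these functions vanish at the corners and tend to [1]
    at the other points of [SG]. *)
Definition exhaust n (x : R * R) : R := 1 - \sum_(l < 3) h l x ^+ n.+1.

Lemma exhaust_corner n i : exhaust n (q i) = 0.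
Proof.
rewrite /exhaust (bigD1 i) //= hb eqxx expr1n big1 ?addr0 ?subrr // => l li.
by rewrite hb (negbTE li) expr0n.
Qed.

Lemma cvgn_energy_exhaust n : cvgn (fun m => energy_level q m (exhaust n) (exhaust n)).
Proof.
apply/cvgn_energyP.
exists (3 * n.+1%:R ^+ 2 * \sum_(l < 3) energy_level q 0 (h l) (h l)) => m.
rewrite (eq_bigr (fun l => energy_level q m (h l) (h l))); last first.
  by move=> l _; rewrite (fh l m).
apply: energy_level_dominated => w i j; rewrite /exhaust.
have B l := sqr_subXX_le n.+1 (harmonic_basis01 l w i) (harmonic_basis01 l w j).
set x := Fw q w (q i) in B *; set y := Fw q w (q j) in B *.
have {}B : \sum_(l < 3) (h l x ^+ n.+1 - h l y ^+ n.+1) ^+ 2 <=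
    n.+1%:R ^+ 2 * \sum_(l < 3) (h l x - h l y) ^+ 2.
  by rewrite mulr_sumr ler_sum.
rewrite -mulrA; apply: le_trans (ler_wpM2l _ B) => //.
rewrite !sum3E; move: (h c0 x ^+ _) (h c1 x ^+ _) (h c2 x ^+ _).
move: (h c0 y ^+ _) (h c1 y ^+ _) (h c2 y ^+ _) => b0 b1 b2 a0 a1 a2.
have := sqr_ge0 ((a0 - b0) - (a1 - b1)); have := sqr_ge0 ((a0 - b0) - (a2 - b2)).
by have := sqr_ge0 ((a1 - b1) - (a2 - b2)); rewrite !expr2; lra.
Qed.

End harmonic_basis.

(** * Geometry of the gasket *)

Section gasket_geometry.
Context {R : realType} (q : 'I_3 -> R * R).
Local Notation plane := (R * R)%type.

Definition Finv (i : 'I_3) (x : plane) : plane :=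
  (2 * x.1 - (q i).1, 2 * x.2 - (q i).2).

Lemma FK i : cancel (F q i) (Finv i).
Proof. by case=> x y; rewrite /F /Finv /=; congr pair; field. Qed.

Lemma FinvK i : cancel (Finv i) (F q i).
Proof. by case=> x y; rewrite /F /Finv /=; congr pair; field. Qed.

Lemma image_F i (A : set plane) : F q i @` A = Finv i @^-1` A.
Proof.
apply/seteqP; split=> [_ [x Ax <-]|x Ax]; first by rewrite /= FK.
by exists (Finv i x) => //; exact: FinvK.
Qed.

Lemma F_scale i (x : plane) : F q i x = 2^-1 *: (x + q i).
Proof. by rewrite /F; congr pair; rewrite mulrC. Qed.

Lemma continuous_F i : continuous (F q i).
Proof.
move=> x; rewrite (_ : F q i = fun y => 2^-1 *: (y + q i)); last first.
  by apply/funext => y; exact: F_scale.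
by apply: cvgZr; apply: cvgD; [exact: cvg_id|exact: cvg_cst].
Qed.

Lemma continuous_Finv i : continuous (Finv i).
Proof.
move=> x; rewrite (_ : Finv i = fun y => 2 *: y - q i) //.
by apply: cvgB; [apply: cvgZr; exact: cvg_id|exact: cvg_cst].
Qed.

Lemma continuous_Fw w : continuous (Fw q w).
Proof.
elim: w => [x|k w IH x]; first exact: cvg_id.
apply: (@continuous_comp _ _ _ (Fw q w) (F q k)); first exact: IH.
exact: continuous_F.
Qed.

Lemma F_dist i (x y : plane) : `|F q i x - F q i y| = `|x - y| / 2.
Proof.
rewrite !F_scale -scalerBr opprD addrACA subrr addr0.
by rewrite normrZ ger0_norm ?invr_ge0 // mulrC.
Qed.

Lemma Fw_dist w (x y : plane) : `|Fw q w x - Fw q w y| = `|x - y| / 2 ^+ size w.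
Proof.
elim: w => [|k w IH]; first by rewrite /= expr0 divr1.
by rewrite !Fw_cons F_dist IH /= exprSr invfM mulrA.
Qed.

Lemma image_Fw_cons k w (A : set plane) :
  Fw q (k :: w) @` A = F q k @` (Fw q w @` A).
Proof. by rewrite image_comp. Qed.

Variable SG : set plane.
Hypothesis hSG : sierpinski_gasket q SG.

Lemma gasketF k x : SG x -> SG (F q k x).
Proof.
by case: hSG => _ _ E Sx; rewrite E; exists k => //; exists x.
Qed.

Lemma gasketFw w x : SG x -> SG (Fw q w x).
Proof. by elim: w => [//|k w IH] /IH; exact: gasketF. Qed.

Lemma gasketP x : SG x -> exists k, exists2 y, SG y & F q k y = x.
Proof.
case: hSG => _ _ E; rewrite {1}E => -[k _ [y Sy yx]].
by exists k, y.
Qed.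

Lemma gasket_cell m x : SG x -> exists w : m.-tuple 'I_3, (Fw q w @` SG) x.
Proof.
elim: m x => [|m IH] x Sx; first by exists [tuple]; exists x.
have [k [y Sy <-]] := gasketP Sx; have [w [z Sz <-]] := IH _ Sy.
by exists [tuple of k :: w]; exists z.
Qed.

Lemma closed_gasket : closed SG.
Proof. by case: hSG => _ /compact_closed + _; apply; exact: norm_hausdorff. Qed.

Lemma closed_cell w : closed (Fw q w @` SG).
Proof.
case: hSG => _ cSG _; apply: compact_closed; first exact: norm_hausdorff.
by apply: continuous_compact => //; apply: continuous_subspaceT; exact: continuous_Fw.
Qed.

Lemma gasket_bounded : exists2 M : R, 0 < M & forall x y, SG x -> SG y -> `|x - y| <= M.
Proof.
case: hSG => _ /compact_bounded[N [_ /(_ (N + 1))]] + _; rewrite ltrDl ltr01.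
move=> /(_ isT) bN; exists (2 * `|N + 1| + 1); first by rewrite ltr_pwDr // mulr_ge0.
move=> x y /bN /= xN /bN /= yN; apply: (le_trans (ler_normB _ _)).
by have := ler_norm (N + 1); lra.
Qed.

Lemma gasket_cell_small (e : R) : 0 < e -> exists m0, forall m, (m0 <= m)%N ->
  forall w : m.-tuple 'I_3, forall x y, SG x -> SG y -> `|Fw q w x - Fw q w y| < e.
Proof.
move=> e0; have [M M0 bM] := gasket_bounded.
have : (fun m => M * 2^-1 ^+ m) @ \oo --> M * 0.
  by apply: cvgM; [exact: cvg_cst|apply: cvg_expr; rewrite ger0_norm; lra].
rewrite mulr0 => /cvgr0_norm_lt /(_ e e0) [m0 _ hm]; exists m0 => m mm w x y Sx Sy.
have := hm m mm; rewrite /= ger0_norm ?mulr_ge0 ?exprn_ge0 ?(ltW M0) //.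
apply: le_lt_trans; rewrite Fw_dist size_tuple exprVn ler_wpM2r ?bM //.
Qed.

(** [F_i^m x] lies in [SG] and tends to the fixed point [q_i]. *)
Lemma gasket_corner i : SG (q i).
Proof.
case: (hSG) => -[x Sx] _ _; apply: closed_gasket => B /nbhs_ballP[e /= e0 eB].
suff [m hm] : exists m, `|q i - Fw q (nseq m i) x| < e.
  exists (Fw q (nseq m i) x); split; first exact: gasketFw.
  by apply: eB; rewrite -ball_normE.
have fix_i m : Fw q (nseq m i) (q i) = q i.
  by elim: m => [//|m IH]; rewrite /= -/(Fw q _ _) IH F_corner.
have : (fun m => `|q i - x| * 2^-1 ^+ m) @ \oo --> `|q i - x| * 0.
  by apply: cvgM; [exact: cvg_cst|apply: cvg_expr; rewrite ger0_norm; lra].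
rewrite mulr0 => /cvgr0_norm_lt /(_ e e0) [m0 _ /(_ m0)]; rewrite /= leqnn => /(_ isT) H.
exists m0; rewrite -{1}(fix_i m0) Fw_dist size_nseq.
by move: H; rewrite exprVn; apply: le_lt_trans; exact: ler_norm.
Qed.

(** The points [F_w q_i] are dense in [SG], because cells shrink. *)
Lemma gasket_ge0 (f : plane -> R) : {within SG, continuous f} ->
  (forall w i, 0 <= f (Fw q w (q i))) -> forall x, SG x -> 0 <= f x.
Proof.
move=> cf f0 x Sx; rewrite leNgt; apply/negP => fx0.
have : nbhs (f x) [set y | y < 0] by apply: lt_nbhsl.
move/(cf x); rewrite /= nbhs_simpl /=.
case: (nbhs_subspaceP SG x) => // _ /= /nbhs_ballP[e /= e0 eB].
have [m /(_ m (leqnn _)) hm] := gasket_cell_small e0.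
have [w [y Sy yx]] := gasket_cell m Sx.
have := f0 w c0; apply/negP; rewrite -ltNge; apply: eB; last first.
  exact/gasketFw/gasket_corner.
by rewrite -ball_normE /= -yx hm //; exact: gasket_corner.
Qed.

Lemma gasket_eq (f g : plane -> R) : {within SG, continuous f} ->
  {within SG, continuous g} ->
  (forall w i, f (Fw q w (q i)) = g (Fw q w (q i))) -> forall x, SG x -> f x = g x.
Proof.
move=> cf cg fg x Sx; apply/eqP; rewrite eq_le -subr_ge0 -(subr_ge0 (g x)).
apply/andP; split; [apply: (@gasket_ge0 (g \- f)) Sx|apply: (@gasket_ge0 (f \- g)) Sx].
- by move=> y; apply: cvgB; [exact: cg|exact: cf].
- by move=> w i; rewrite /= fg subrr.
- by move=> y; apply: cvgB; [exact: cf|exact: cg].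
- by move=> w i; rewrite /= fg subrr.
Qed.

Lemma within_continuous_F (f : plane -> R) k : {within SG, continuous f} ->
  {within SG, continuous (f \o F q k)}.
Proof.
move=> /continuousP cf; apply/continuousP => U /cf /open_subspaceP[V oV VU].
apply/open_subspaceP; exists (F q k @^-1` V).
  by move/continuousP : (continuous_F (i := k)); apply.
apply/seteqP; split=> x [Vx Sx]; split=> //.
- have : (V `&` SG) (F q k x) by split => //; exact: gasketF.
  by rewrite VU => -[].
- have : ((f : subspace SG -> R) @^-1` U `&` SG) (F q k x) by split => //; exact: gasketF.
  by rewrite -VU => -[].
Qed.

End gasket_geometry.

Section barycentric.
Context {R : realType} (q : 'I_3 -> R * R).
Local Notation plane := (R * R)%type.

(** Twice the signed area of the triangle [x, a, b]. *)
Definition area2 (a b x : plane) : R :=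
  (a.2 - b.2) * x.1 + (b.1 - a.1) * x.2 + (a.1 * b.2 - b.1 * a.2).

Lemma area2_half a b x y : area2 a b ((x.1 + y.1) / 2, (x.2 + y.2) / 2) =
  (area2 a b x + area2 a b y) / 2.
Proof. by rewrite /area2 /=; field. Qed.

Lemma continuous_area2 a b : continuous (area2 a b).
Proof.
move=> x; apply: cvgD; last exact: cvg_cst.
apply: cvgD; apply: cvgM; try exact: cvg_cst.
  exact: cvg_fst.
exact: cvg_snd.
Qed.

Definition bary (i : 'I_3) (x : plane) : R :=
  match val i with
  | 0 => area2 (q c1) (q c2) x
  | 1 => area2 (q c2) (q c0) x
  | _ => area2 (q c0) (q c1) x
  end / area2 (q c1) (q c2) (q c0).

Hypothesis hq : equilateral q.

Lemma equilateral_area2 : area2 (q c1) (q c2) (q c0) != 0.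
Proof.
case: hq => l l0 hl.
have E i j : i != j ->
    ((q i).1 - (q j).1) ^+ 2 + ((q i).2 - (q j).2) ^+ 2 = l ^+ 2.
  by move=> ij; rewrite -(hl i j ij) /edist sqr_sqrtr // addr_ge0 ?sqr_ge0.
have := E c0 c1 isT; have := E c0 c2 isT; have := E c1 c2 isT.
move=> E12 E02 E01; rewrite -sqrf_eq0.
suff -> : area2 (q c1) (q c2) (q c0) ^+ 2 = 3 / 4 * (l ^+ 2) ^+ 2.
  by rewrite gt_eqF // mulr_gt0 ?divr_gt0 // !exprn_gt0.
(* The inner product of two sides is [l ^ 2 / 2], and Lagrange's identity gives the
   square of the determinant. *)
pose dot := ((q c1).1 - (q c0).1) * ((q c2).1 - (q c0).1) +
            ((q c1).2 - (q c0).2) * ((q c2).2 - (q c0).2).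
have dotE : dot = l ^+ 2 / 2.
  rewrite (_ : dot = (l ^+ 2 + l ^+ 2 - l ^+ 2) / 2); last first.
    by rewrite -{1}E01 -{1}E02 -E12 /dot; field.
  by rewrite addrK.
rewrite (_ : area2 _ _ _ ^+ 2 = l ^+ 2 * l ^+ 2 - dot ^+ 2); last first.
  by rewrite -{1}E01 -{1}E02 /dot /area2; ring.
by rewrite dotE; field.
Qed.

Lemma bary_corner i j : bary i (q j) = (i == j)%:R.
Proof.
have := equilateral_area2; rewrite /bary /area2 => D0.
by elim/ord3_ind: i; elim/ord3_ind: j => /=; field.
Qed.

Lemma bary_sum x : \sum_(i < 3) bary i x = 1.
Proof.
have := equilateral_area2; rewrite sum3E /bary /area2 /= => D0.
by field.
Qed.

Lemma bary_F i k x : bary i (F q k x) = (bary i x + (i == k)%:R) / 2.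
Proof.
rewrite -bary_corner /bary /F.
by case: (val i) => [|[|?]]; rewrite area2_half mulrAC mulrDl.
Qed.

Lemma bary_inj x y : (forall i, bary i x = bary i y) -> x = y.
Proof.
have E z : z = (\sum_(i < 3) bary i z * (q i).1, \sum_(i < 3) bary i z * (q i).2).
  have := equilateral_area2; rewrite !sum3E /bary /area2 /= => D0.
  by case: z => z1 z2 /=; congr pair; field.
move=> xy; rewrite (E x) (E y).
by congr pair; apply: eq_bigr => i _; rewrite xy.
Qed.

Lemma continuous_bary i : continuous (bary i).
Proof.
move=> x; apply: cvgM; last exact: cvg_cst.
by case: (val i) => [|[|?]]; exact: continuous_area2.
Qed.

Variable SG : set plane.
Hypothesis hSG : sierpinski_gasket q SG.

Lemma gasket_bary_ge0 i x : SG x -> 0 <= bary i x.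
Proof.
apply: (gasket_ge0 hSG) => [|w p].
  by apply: continuous_subspaceT; exact: continuous_bary.
elim: w => [|k w IH]; first by rewrite /= bary_corner ler0n.
by rewrite Fw_cons bary_F divr_ge0 // addr_ge0 // ler0n.
Qed.

(** The barycentric coordinate at [q_j] is at least [1/2] on [F_j SG] and at most
    [1/2] on [F_k SG], with equality in the latter case only at [F_k q_j]. *)
Lemma gasket_overlap j k x y : j != k -> SG x -> SG y -> F q j x = F q k y -> y = q j.
Proof.
move=> jk Sx Sy /(congr1 (bary j)); rewrite !bary_F eqxx (negbTE jk) /= addr0 => E.
have y1 : 1 <= bary j y by have := gasket_bary_ge0 j Sx; lra.
apply: bary_inj => i; rewrite bary_corner.
have := bary_sum y; rewrite (bigD1 j) //=.
have [-> S|ij] := eqVneq i j; rewrite ?eqxx /=.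
  have : 0 <= \sum_(i < 3 | i != j) bary i y.
    by apply: sumr_ge0 => l _; exact: gasket_bary_ge0.
  by move=> ?; apply/eqP; rewrite eq_le y1 andbT; lra.
rewrite (bigD1 i) //=.
have : 0 <= \sum_(l < 3 | (l != j) && (l != i)) bary l y.
  by apply: sumr_ge0 => l _; exact: gasket_bary_ge0.
have := gasket_bary_ge0 i Sy => ? ? ?.
by apply/eqP; rewrite eq_le; apply/andP; split; lra.
Qed.

Definition transplant j (v : plane -> R) (x : plane) : R :=
  if x \in F q j @` SG then v (Finv q j x) else 0.

Lemma transplant_in j v x : SG x -> transplant j v (F q j x) = v x.
Proof.
by move=> Sx; rewrite /transplant mem_set ?FK.
Qed.

Lemma transplant_out j k v x : (forall i, v (q i) = 0) -> k != j -> SG x ->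
  transplant j v (F q k x) = 0.
Proof.
move=> v0 kj Sx; rewrite /transplant; case: ifPn => // /set_mem[y Sy yx].
by rewrite -yx FK (gasket_overlap kj Sx Sy (esym yx)) v0.
Qed.

Lemma transplantP j v : (forall i, v (q i) = 0) -> transplant_of q j (transplant j v) v.
Proof.
move=> v0 k w i; have S := gasketFw hSG w (gasket_corner hSG i).
by case: eqP => [->|/eqP kj]; [exact: transplant_in|exact: transplant_out].
Qed.

Lemma transplant_corner j v i : (forall i, v (q i) = 0) -> transplant j v (q i) = 0.
Proof.
move=> v0; have := transplantP j v0 i [::] i.
by rewrite /= F_corner v0 if_same.
Qed.

(** [SG] is the union of the closed sets [F_j SG] and [B], the other two cells; the
    two definitions agree where these meet, by [gasket_overlap]. *)
Lemma within_continuous_transplant j v : (forall i, v (q i) = 0) ->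
  {within SG, continuous v} -> {within SG, continuous (transplant j v)}.
Proof.
move=> v0 cv.
pose A := F q j @` SG; pose B := \bigcup_(k in [set k | k != j]) (F q k @` SG).
have SE : SG = A `|` B.
  apply/seteqP; split=> [x /(gasketP hSG)[k [y Sy <-]]|x [[y Sy <-]|[k _ [y Sy <-]]]].
  - have [->|kj] := eqVneq k j; first by left; exists y.
    by right; exists k => //; exists y.
  - exact: (gasketF hSG).
  - exact: (gasketF hSG).
have cA : closed A by exact: (closed_cell hSG (w := [:: j])).
have cB : closed B.
  by apply: closed_bigcup => [|k _]; [exact: finite_finset|exact: (closed_cell hSG (w := [:: k]))].
rewrite SE; apply: withinU_continuous => //.
- apply/continuousP => U oU.
  move/continuousP : cv => /(_ U oU)/open_subspaceP[V oV VU].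
  apply/open_subspaceP; exists (Finv q j @^-1` V).
    by move/continuousP : (@continuous_Finv _ q j); apply.
  apply/seteqP; split=> z [+ [x Sx xz]]; rewrite -{z}xz /= ?FK => xV; split.
  + have : (V `&` SG) x by [].
    by rewrite VU => -[] /=; rewrite /from_subspace transplant_in.
  + by exists x.
  + have : ((v : subspace SG -> R) @^-1` U `&` SG) x.
      by split => //; move: xV; rewrite /from_subspace transplant_in.
    by rewrite -VU => -[].
  + by exists x.
- have E x : B x -> transplant j v x = 0.
    by move=> [k kj [y Sy <-]]; exact: transplant_out.
  apply: (@subspace_eq_continuous _ B R (cst 0)).
    by move=> x /set_mem Bx; exact/esym/E.
  by apply: continuous_subspaceT => x; exact: cvg_cst.
Qed.

End barycentric.

(** * Measures determined by cells *)

Definition union_seq T (I : eqType) (A : I -> set T) (r : seq I) : set T :=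
  [set x | exists2 i, i \in r & A i x].

Section almost_disjoint_unions.
Local Open Scope ereal_scope.
Context d (T : measurableType d) {R : realType} (I : eqType).
Variables (mu : {finite_measure set T -> \bar R}) (A : I -> set T).
Hypothesis mA : forall i, measurable (A i).

Local Notation union := (union_seq A).

Let measureU_finite B C : measurable B -> measurable C ->
  mu (B `|` C) = mu B + mu C - mu (B `&` C).
Proof.
by move=> mB mC; apply: measureUfinl => //; rewrite ltey_eq fin_num_measure.
Qed.

Let measureU_le B C : measurable B -> measurable C ->
  mu (B `|` C) <= mu B + mu C.
Proof. exact: measureU2. Qed.

Let union_nil : union [::] = set0.
Proof. by apply/seteqP; split=> x // []. Qed.

Let union_cons i r : union (i :: r) = A i `|` union r.
Proof.
apply/seteqP; split=> [x [j]|x [Ai|[j jr Aj]]].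
- by rewrite in_cons => /orP[/eqP ->|jr] Aj; [left|right; exists j].
- by exists i; rewrite ?mem_head.
- by exists j => //; rewrite in_cons jr orbT.
Qed.

Lemma measurable_union_seq r : measurable (union r).
Proof.
elim: r => [|i r IH]; first by rewrite union_nil.
by rewrite union_cons; exact: measurableU.
Qed.

Lemma measure_union_seq_le r : mu (union r) <= \sum_(i <- r) mu (A i).
Proof.
elim: r => [|i r IH]; first by rewrite union_nil measure0 big_nil.
rewrite union_cons big_cons; apply: le_trans (leeD2l _ IH).
by apply: measureU_le => //; exact: measurable_union_seq.
Qed.

Lemma measure_union_seq r : uniq r ->
  (forall i j, i \in r -> j \in r -> i != j -> mu (A i `&` A j) = 0) ->
  mu (union r) = \sum_(i <- r) mu (A i).
Proof.
elim: r => [|i r IH] /=; first by rewrite union_nil measure0 big_nil.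
move=> /andP[ir ur] A0; rewrite union_cons big_cons -IH //; last first.
  by move=> k l kr lr; apply: A0; rewrite in_cons ?kr ?lr orbT.
have mr := measurable_union_seq r.
rewrite measureU_finite //.
suff -> : mu (A i `&` union r) = 0 by rewrite sube0.
apply/eqP; rewrite eq_le measure_ge0 andbT.
have {}A0 j : j \in r -> mu (A i `&` A j) = 0.
  move=> jr; apply: A0; rewrite ?mem_head ?in_cons ?jr ?orbT //.
  by apply: contraNneq ir => ->.
elim: (r) A0 => [_|j s IHs A0]; first by rewrite union_nil setI0 measure0.
rewrite union_cons setIUr.
have ms := measurable_union_seq s.
apply: le_trans (measureU_le _ _) _; [exact: measurableI|exact: measurableI|].
rewrite A0 ?mem_head // add0e; apply: IHs => k ks.
by rewrite A0 // in_cons ks orbT.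
Qed.

(** Inclusion-exclusion for [A i] and [A j] and subadditivity for the other sets:
    mass in the overlap would be counted twice in the sum. *)
Lemma measure_overlap0 r i j : uniq r -> i \in r -> j \in r -> i != j ->
  \sum_(l <- r) mu (A l) <= mu (union r) -> mu (A i `&` A j) = 0.
Proof.
move=> ur ir jr ij S.
pose s := rem j (rem i r).
have pr : perm_eq r [:: i, j & s].
  apply: (perm_trans (perm_to_rem ir)); rewrite perm_cons; apply: perm_to_rem.
  by rewrite mem_rem_uniq // inE eq_sym ij.
have ru : union r = union [:: i, j & s].
  by apply/seteqP; split=> x [k kr Ak]; exists k => //; move: kr; rewrite (perm_mem pr).
move: S; rewrite (perm_big _ pr) /= ru !big_cons 2!union_cons setUA.
move=> S; have ms := measurable_union_seq s.
have := le_trans S (measureU_le (measurableU _ _ (mA i) (mA j)) ms).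
rewrite measureU_finite //.
move/le_trans => /(_ _ (leeD2l _ (measure_union_seq_le s))).
have sfin : \sum_(l <- s) mu (A l) \is a fin_num.
  by apply/sum_fin_numP => l _ _; exact: fin_num_measure.
have mAij : measurable (A i `&` A j) by exact: measurableI.
rewrite -(fineK sfin) -(fineK (fin_num_measure mu _ (mA i))).
rewrite -(fineK (fin_num_measure mu _ (mA j))) -(fineK (fin_num_measure mu _ mAij)).
rewrite -!EFinD lee_fin => H; congr (_%:E); apply/eqP; rewrite eq_le.
rewrite fine_ge0 ?measure_ge0 // andbT.
by move: H; set a := fine _; set b := fine _; set c := fine _; set e := fine _; lra.
Qed.

End almost_disjoint_unions.

Section borel_plane_measurability.
Context {R : realType}.
Local Notation plane := (R * R)%type.

Lemma closed_measurable_plane (K : set plane) : closed K ->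
  measurable (K : set (borel_plane R)).
Proof.
move=> cK; rewrite -(setCK K); apply: (@measurableC _ (borel_plane R)).
by apply: sub_sigma_algebra; exact: closed_openC.
Qed.

Lemma continuous_measurable_plane (f : plane -> plane) : continuous f ->
  measurable_fun setT (f : borel_plane R -> borel_plane R).
Proof.
move=> /continuousP cf.
apply: (@measurability _ _ (borel_plane R) (borel_plane R) setT f (@open plane)) => //.
move=> _ [U oU <-]; rewrite setTI; apply: sub_sigma_algebra; exact: cf.
Qed.

Lemma within_continuous_measurable_plane (K : set plane) (f : plane -> R) :
  closed K -> {within K, continuous f} ->
  measurable_fun (K : set (borel_plane R)) (f : borel_plane R -> R).
Proof.
move=> cK /continuousP cf; apply: (measurability _ (measurable_realfun.RGenOpens.measurableE R)).
move=> _ [_ [a [b ->] <-]].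
have oI : open `]a, b[%classic by exact: interval_open.
have /open_subspaceP[V oV VU] := cf _ oI.
rewrite setIC (_ : _ `&` K = V `&` K) //; apply: measurableI.
  by apply: sub_sigma_algebra.
exact: closed_measurable_plane.
Qed.

End borel_plane_measurability.

Section cell_uniqueness.
Local Open Scope ereal_scope.
Context {R : realType} (q : 'I_3 -> R * R) (SG : set (R * R)).
Hypothesis hSG : sierpinski_gasket q SG.
Local Notation plane := (R * R)%type.
Local Notation cell w := (Fw q w @` SG : set (borel_plane R)).

Lemma measurable_cell w : measurable (cell w).
Proof. by apply: closed_measurable_plane; exact: closed_cell. Qed.

Lemma measurable_gasket : measurable (SG : set (borel_plane R)).
Proof. by apply: closed_measurable_plane; exact: closed_gasket hSG. Qed.

Lemma measure_unique_closed (m1 m2 : {finite_measure set (borel_plane R) -> \bar R}) :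
  (forall K : set plane, closed K -> m1 K = m2 K) ->
  forall A, measurable A -> m1 A = m2 A.
Proof.
move=> m12; apply: (@measure_unique _ R (borel_plane R) (@closed plane) (fun=> setT)) => //.
- apply/seteqP; split; apply: smallest_sub; try exact: smallest_sigma_algebra.
    move=> U oU; rewrite -(setCK U).
    apply: (sigma_algebraC (G := @closed plane)).
    by apply: sub_sigma_algebra; exact: open_closedC.
  by move=> K cK; exact: closed_measurable_plane.
- exact: closedI.
- by apply/seteqP; split=> // x _; exists 0%N.
- by move=> _; rewrite ltey_eq fin_num_measure.
Qed.

(** A closed set is the decreasing limit of the unions [C m] of the cells of level
    [m] that meet it; as the cells of one level are almost disjoint, the measure
    of [C m] is the sum of the measures of these cells. *)
Lemma cell_measure_unique (m1 m2 : {finite_measure set (borel_plane R) -> \bar R}) :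
  m1 (~` SG) = 0 -> m2 (~` SG) = 0 ->
  (forall m (w w' : m.-tuple 'I_3), w != w' -> m1 (cell w `&` cell w') = 0) ->
  (forall m (w w' : m.-tuple 'I_3), w != w' -> m2 (cell w `&` cell w') = 0) ->
  (forall w, m1 (cell w) = m2 (cell w)) ->
  forall A, measurable A -> m1 A = m2 A.
Proof.
move=> n1 n2 o1 o2 m12; apply: measure_unique_closed => K cK.
have mK := closed_measurable_plane cK.
pose r m := [seq w : m.-tuple 'I_3 <- enum {: m.-tuple 'I_3} | `[< (cell w `&` K) !=set0 >] ].
pose C m : set (borel_plane R) := union_seq (fun w : m.-tuple 'I_3 => cell w) (r m).
have mC m : measurable (C m).
  apply: (measurable_union_seq (A := fun w : m.-tuple 'I_3 => cell w)) => w.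
  exact: measurable_cell.
have CE (mu : {finite_measure set (borel_plane R) -> \bar R}) m :
    (forall w w' : m.-tuple 'I_3, w != w' -> mu (cell w `&` cell w') = 0) ->
    mu (C m) = \sum_(w <- r m) mu (cell w).
  move=> o; apply: (measure_union_seq (mu := mu) (A := fun w : m.-tuple 'I_3 => cell w)).
  - by move=> w; exact: measurable_cell.
  - by rewrite filter_uniq // enum_uniq.
  - by move=> w w' _ _; exact: o.
have Cdecr : {homo C : n m / (n <= m)%N >-> (m <= n)%O}.
  apply: homo_leq => [A //|A B D AB BD|n]; first by apply: (le_trans BD).
  apply/subsetPset => x [w].
  rewrite mem_filter => /andP[/asboolP[y [wy Ky]] _] wx.
  have sz : size (take n w) == n by rewrite size_takel // size_tuple.
  have wE : w = take n w ++ drop n w :> seq 'I_3 by rewrite cat_take_drop.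
  have sub : cell w `<=` cell (take n w).
    rewrite {1}wE => _ [z Sz <-]; rewrite Fw_cat; exists (Fw q (drop n w) z) => //.
    exact: gasketFw.
  exists (Tuple sz); last exact: sub.
  rewrite mem_filter mem_enum andbT; apply/asboolP; exists y; split => //.
  exact: sub.
have KE : K `&` SG = \bigcap_m C m.
  apply/seteqP; split=> [x [Kx Sx] m _|x Cx].
    have [w wx] := gasket_cell hSG m Sx.
    exists w => //; rewrite mem_filter mem_enum andbT; apply/asboolP.
    by exists x.
  split; last first.
    by have [w _ [z Sz <-]] := Cx 0%N I; exact: gasketFw.
  apply: cK => B /nbhs_ballP[e /= e0 eB].
  have [m /(_ m (leqnn _)) hm] := gasket_cell_small hSG e0.
  have [w] := Cx m I; rewrite mem_filter => /andP[/asboolP[_ [[y Sy <-] Ky]] _] [z Sz zx].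
  exists (Fw q w y); split => //; apply: eB.
  by rewrite -ball_normE /= -zx; exact: hm.
have E (mu : {finite_measure set (borel_plane R) -> \bar R}) :
    mu (~` SG) = 0 -> mu K = mu (\bigcap_m C m).
  move=> n; rewrite -KE.
  have -> : mu K = mu (K `\` SG) + mu (K `&` SG).
    by apply: measureDI => //; exact: measurable_gasket.
  suff -> : mu (K `\` SG) = 0 by rewrite add0e.
  apply/eqP; rewrite eq_le measure_ge0 andbT -n; apply: le_measure; rewrite ?inE.
  - by apply: measurableD => //; exact: measurable_gasket.
  - by apply: measurableC; exact: measurable_gasket.
  - by move=> x [].
rewrite (E _ n1) (E _ n2).
have L (mu : {finite_measure set (borel_plane R) -> \bar R}) :
    (mu \o C) @ \oo --> mu (\bigcap_m C m).
  apply: nonincreasing_cvg_mu => //; first by rewrite ltey_eq fin_num_measure.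
  by apply: bigcapT_measurable.
have := L m1; rewrite (_ : m1 \o C = m2 \o C).
  by move/(cvg_unique _ (L m2)) => ->.
apply/funext => m /=.
by rewrite (CE m1 m (o1 m)) (CE m2 m (o2 m)); apply: eq_bigr => w _; exact: m12.
Qed.

End cell_uniqueness.

(** * Finite measures and densities *)

Section finite_copy.
Local Open Scope ereal_scope.
Context d (T : measurableType d) (R : realType) (m : {measure set T -> \bar R}).
Hypothesis moo : m setT < +oo.

(** The proof of finiteness is an argument, so that the structure of finite measure
    can be inferred from the term. *)
Definition finite_copy & m setT < +oo : set T -> \bar R := m.
Local Notation fm := (finite_copy moo).

Let fm0 : fm set0 = 0. Proof. exact: measure0. Qed.

Let fm_ge0 A : 0 <= fm A. Proof. exact: measure_ge0. Qed.

Let fm_sigma : semi_sigma_additive fm.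
Proof. exact: measure_semi_sigma_additive. Qed.

HB.instance Definition _ := isMeasure.Build _ _ _ fm fm0 fm_ge0 fm_sigma.

Let fm_fin : fin_num_fun fm. Proof. exact: lty_fin_num_fun. Qed.

HB.instance Definition _ := @Measure_isFinite.Build _ _ _ fm fm_fin.

End finite_copy.

Section densities.
Local Open Scope ereal_scope.
Context d (T : measurableType d) (R : realType).

Lemma restricted_image_measure (m : {finite_measure set T -> \bar R})
    (D : set T) (g : T -> T) : measurable D -> measurable_fun setT g ->
  exists m' : {finite_measure set T -> \bar R}, forall A, m' A = m (g @^-1` A `&` D).
Proof.
move=> mD mg; pose push : {measure set T -> \bar R} := pushforward (mrestr m mD) g.
pose m0 := push mg.
have m0oo : m0 setT < +oo.
  rewrite /m0 /push /= /pushforward /mrestr preimage_setT setTI.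
  by rewrite ltey_eq fin_num_measure.
by exists (finite_copy m0oo).
Qed.

Lemma finite_combination (m1 m2 : {finite_measure set T -> \bar R}) (a b : R) :
  (0 <= a)%R -> (0 <= b)%R ->
  exists m : {finite_measure set T -> \bar R},
    forall A, m A = a%:E * m1 A + b%:E * m2 A.
Proof.
move=> a0 b0.
pose m0 : {measure set T -> \bar R} :=
  measure_add (mscale (NngNum a0) m1) (mscale (NngNum b0) m2).
have m0E A : m0 A = a%:E * m1 A + b%:E * m2 A by exact: measure_addE.
have m0oo : m0 setT < +oo.
  rewrite m0E ltey_eq; apply/orP; left.
  by rewrite fin_numD !fin_numM // fin_num_measure.
by exists (finite_copy m0oo).
Qed.

(** Up to a null set the derivative is nonnegative, which reduces the claim to the
    change of variables for [`|f|]. *)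
Lemma integrable_Radon_Nikodym (nu : {finite_measure set T -> \bar R})
    (mu : {sigma_finite_measure set T -> \bar R}) (f : T -> \bar R) (E : set T) :
  nu `<< mu -> measurable E -> nu.-integrable E f ->
  mu.-integrable E (f \* Radon_Nikodym (charge_of_finite_measure nu) mu).
Proof.
move=> numu mE intf; have mf := measurable_int _ intf.
have mRN : measurable_fun E (Radon_Nikodym (charge_of_finite_measure nu) mu : T -> \bar R).
  by apply: measurable_funTS; apply: measurable_int; exact: Radon_Nikodym_integrable.
have mSF : measurable_fun E (Radon_Nikodym_SigmaFinite.f nu mu : T -> \bar R).
  apply: measurable_funTS; apply: (measurable_int mu).
  exact: Radon_Nikodym_SigmaFinite.f_integrable.
apply/integrableP; split; first exact: emeasurable_funM.
case/integrableP : intf => _.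
rewrite -(Radon_Nikodym_SigmaFinite.change_of_variables numu) //; last first.
  exact: measurableT_comp.
congr (_ < _); apply: ae_eq_integral => //.
- by apply: emeasurable_funM => //; exact: measurableT_comp.
- by apply: measurableT_comp => //; exact: emeasurable_funM.
- have := ae_eq_Radon_Nikodym_SigmaFinite numu mE.
  apply: filterS => x /= fg Ex; rewrite abseM -fg //.
  rewrite (gee0_abs (x := Radon_Nikodym_SigmaFinite.f _ _ _)) //.
  exact: Radon_Nikodym_SigmaFinite.f_ge0.
Qed.

End densities.

(** * Self-similarity of the Kusuoka measure *)

Section kusuoka_selfsimilarity.
Local Open Scope ereal_scope.
Context {R : realType} (q : 'I_3 -> R * R) (SG : set (R * R)).
Context (h : 'I_3 -> R * R -> R).
Context (nu_ : 'I_3 -> {finite_measure set (borel_plane R) -> \bar R}).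
Hypotheses (hq : equilateral q) (hSG : sierpinski_gasket q SG)
  (hharm : forall i, sg_harmonic q SG (h i))
  (hbd : forall i j, h i (q j) = (i == j)%:R)
  (hnu : forall i, energy_measure q SG (h i) (nu_ i)).
Local Notation nu := (kusuoka nu_).
Local Notation cell w := (Fw q w @` SG : set (borel_plane R)).

Lemma kusuokaE (A : set (borel_plane R)) : nu A = \sum_(i < 3) nu_ i A.
Proof. by []. Qed.

Lemma flat_harmonic i : flat q (h i).
Proof. by move=> m; exact: (hharm i).2. Qed.

Lemma nu_cell i w : nu_ i (cell w) =
  ((5 / 3) ^+ size w * energy_level q 0 (h i \o Fw q w) (h i \o Fw q w))%:E.
Proof.
have [_ ->] := hnu i.
by rewrite energy_flat //; apply: flat_Fw; exact: flat_harmonic.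
Qed.

Lemma kusuoka_cell w : nu (cell w) = ((5 / 3) ^+ size w *
  \sum_(i < 3) energy_level q 0 (h i \o Fw q w) (h i \o Fw q w))%:E.
Proof.
rewrite kusuokaE mulr_sumr -sumEFin; apply: eq_bigr => i _.
exact: nu_cell.
Qed.

Lemma nu_outside i : nu_ i (~` SG) = 0.
Proof. by have [] := hnu i. Qed.

(** The measures of the cells of level [m] add up to the energy of [h_i], which is
    the measure of [SG]: no mass is left for the overlaps. *)
Lemma nu_overlap i m (w w' : m.-tuple 'I_3) : w != w' ->
  nu_ i (cell w `&` cell w') = 0.
Proof.
move=> ww'.
apply: (@measure_overlap0 _ _ _ _ (nu_ i) (fun w : m.-tuple 'I_3 => cell w) _
          (enum {: m.-tuple 'I_3})); rewrite ?enum_uniq ?mem_enum //.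
  by move=> v; exact: measurable_cell.
rewrite (eq_bigr _ (fun v _ => nu_cell i _)) sumEFin big_enum /=.
under eq_bigr do rewrite size_tuple.
rewrite -mulr_sumr -flat_cells; last exact: flat_harmonic.
have := nu_cell i [::]; rewrite /= expr0 mul1r => <-.
apply: le_measure; rewrite ?inE; first exact: (measurable_cell hSG [::]).
  apply: (measurable_union_seq (A := fun w : m.-tuple 'I_3 => cell w)) => v.
  exact: measurable_cell.
move=> _ [x Sx <-]; have [v vx] := gasket_cell hSG m Sx.
by exists v => //; rewrite mem_enum.
Qed.

Lemma kusuoka_outside : nu (~` SG) = 0.
Proof. by rewrite kusuokaE big1 // => i _; exact: nu_outside. Qed.

Lemma kusuoka_overlap m (w w' : m.-tuple 'I_3) : w != w' ->
  nu (cell w `&` cell w') = 0.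
Proof. by move=> ww'; rewrite kusuokaE big1 // => i _; exact: nu_overlap. Qed.

Lemma nu_dominated j : nu_ j `<< nu.
Proof.
apply/null_content_dominatesP => A mA; rewrite [X in X = 0 -> _]kusuokaE => /eqP.
rewrite (bigD1 j) //= padde_eq0 ?measure_ge0 ?sume_ge0 //.
by move=> /andP[/eqP].
Qed.

(** Both sides are measures carried by [SG], so it is enough to compare them on cells,
    where the equality is [kusuoka_cell_energy]. *)
Lemma kusuoka_selfsimilar j (A : set (borel_plane R)) : measurable A ->
  nu (Finv q j @^-1` A `&` F q j @` SG) = (1 / 15)%:E * nu A + (4 / 5)%:E * nu_ j A.
Proof.
have mD : measurable (F q j @` SG : set (borel_plane R)) by exact: (measurable_cell hSG [:: j]).
have mG : measurable_fun setT (Finv q j : borel_plane R -> borel_plane R).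
  by apply: continuous_measurable_plane; exact: continuous_Finv.
have [m1 m1E] := restricted_image_measure (kusuoka nu_) mD mG.
have [m2 m2E] : exists m : {finite_measure set (borel_plane R) -> \bar R},
    forall A, m A = (1 / 15)%:E * nu A + (4 / 5)%:E * nu_ j A.
  by apply: finite_combination; rewrite divr_ge0.
rewrite -m1E -m2E; move: A.
have cellF w : Finv q j @^-1` (cell w) `&` F q j @` SG = cell (j :: w).
  rewrite -image_F -image_Fw_cons; apply/setIidl => _ [x Sx <-].
  by rewrite Fw_cons; exists (Fw q w x) => //; exact: gasketFw.
apply: (cell_measure_unique hSG).
- rewrite m1E (_ : _ `&` _ = set0) ?measure0 //.
  by apply/seteqP; split=> // x [/= nS [y Sy yx]]; apply: nS; rewrite -yx FK.
- by rewrite m2E kusuoka_outside nu_outside !mule0 adde0.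
- move=> m w w' ww'; rewrite m1E preimage_setI setIIl !cellF.
  apply: (@kusuoka_overlap m.+1 [tuple of j :: w] [tuple of j :: w']).
  by apply: contra ww' => /eqP[]/eqP.
- by move=> m w w' ww'; rewrite m2E kusuoka_overlap // nu_overlap // !mule0 adde0.
move=> w; rewrite m1E m2E cellF (kusuoka_cell w) nu_cell -!EFinM -EFinD.
transitivity (nu (cell (j :: w))) => //; rewrite kusuoka_cell; congr EFin.
by rewrite (kusuoka_cell_energy flat_harmonic hbd) /= exprS; field.
Qed.

End kusuoka_selfsimilarity.

(** * The Laplacian on a cell *)

Section cell_laplacian.
Local Open Scope ereal_scope.
Context {R : realType} (q : 'I_3 -> R * R) (SG : set (R * R)).
Context (h : 'I_3 -> R * R -> R).
Context (nu_ : 'I_3 -> {finite_measure set (borel_plane R) -> \bar R}).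
Hypotheses (hq : equilateral q) (hSG : sierpinski_gasket q SG)
  (hharm : forall i, sg_harmonic q SG (h i))
  (hbd : forall i j, h i (q j) = (i == j)%:R)
  (hnu : forall i, energy_measure q SG (h i) (nu_ i)).
Local Notation nu := (kusuoka nu_).
Local Notation gasket := (SG : set (borel_plane R)).
Local Notation cell1 j := (F q j @` SG : set (borel_plane R)).

Let mSG : measurable gasket. Proof. exact: measurable_gasket hSG. Qed.

Let mcell1 j : measurable (cell1 j).
Proof. exact: (measurable_cell hSG [:: j]). Qed.

Let mG j : measurable_fun setT (Finv q j : borel_plane R -> borel_plane R).
Proof. by apply: continuous_measurable_plane; exact: continuous_Finv. Qed.

Let mF j : measurable_fun setT (F q j : borel_plane R -> borel_plane R).
Proof. by apply: continuous_measurable_plane; exact: continuous_F. Qed.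

Lemma integrable_RN i : nu.-integrable setT (RN nu_ i).
Proof. exact/Radon_Nikodym_integrable/nu_dominated. Qed.

Lemma integral_RN i (A : set (borel_plane R)) : measurable A ->
  \int[nu]_(x in A) RN nu_ i x = nu_ i A.
Proof.
move=> mA; rewrite -Radon_Nikodym_integral //; exact: nu_dominated.
Qed.

(** By [kusuoka_selfsimilar] the derivative and [5/3 Q_j] have the same integral over
    every Borel set; [5/3] is the factor by which energies scale in a cell. *)
Lemma cell_image_density j : exists2 P : {finite_measure set (borel_plane R) -> \bar R},
  forall A, P A = nu (Finv q j @^-1` A `&` cell1 j) &
  P `<< nu /\ ae_eq nu setT
    (Radon_Nikodym (charge_of_finite_measure P) nu : borel_plane R -> \bar R)
    (fun x => (5 / 3)%:E * Q nu_ j x).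
Proof.
have [P PE] := restricted_image_measure (kusuoka nu_) (mcell1 j) (mG j).
have PA (A : set (borel_plane R)) : measurable A ->
    P A = (1 / 15)%:E * nu A + (4 / 5)%:E * nu_ j A.
  by move=> mA; rewrite PE; exact: kusuoka_selfsimilar.
have Pnu : P `<< nu.
  apply/null_content_dominatesP => A mA nuA0; rewrite PA //.
  have /null_content_dominatesP -> // := nu_dominated (nu_ := nu_) j.
  by have -> : nu A = 0 by []; rewrite !mule0 adde0.
have intR : nu.-integrable setT (fun x => (12 / 25)%:E * RN nu_ j x).
  by apply: integrableZl => //; exact: integrable_RN.
have intc : nu.-integrable setT (fun=> (1 / 25)%:E : \bar R).
  by apply: finite_measure_integrable_cst.
have intQ : nu.-integrable setT (Q nu_ j) by exact: integrableD.
exists P => //; split => //; apply: integral_ae_eq => //.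
- exact: Radon_Nikodym_integrable.
- apply: (measurable_int nu); exact: integrableZl.
- move=> A _ mA; transitivity (P A).
    by symmetry; exact: (Radon_Nikodym_integral (nu := charge_of_finite_measure P)).
  have sub f : nu.-integrable setT f -> nu.-integrable A f.
    by apply: integrableS.
  rewrite integralZl //; last exact: sub.
  rewrite PA // /Q integralD //; [|exact: sub|exact: sub].
  rewrite (integral_cst nu mA (1 / 25)%:E) integralZl //; last exact/sub/integrable_RN.
  rewrite integral_RN //.
  have combine (a b : \bar R) : a \is a fin_num -> b \is a fin_num ->
      (1 / 15)%:E * a + (4 / 5)%:E * b =
      (5 / 3)%:E * ((1 / 25)%:E * a + (12 / 25)%:E * b).
    by case: a b => [a| |] [b| |] // _ _; congr EFin; field.
  by apply: combine; exact: fin_num_measure.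
Qed.

Lemma cell_change_of_variables j (P : {finite_measure set (borel_plane R) -> \bar R})
    (w : borel_plane R -> R) :
  (forall A, P A = nu (Finv q j @^-1` A `&` cell1 j)) ->
  nu.-integrable (cell1 j) (EFin \o w) ->
  P.-integrable gasket (EFin \o w \o F q j) /\
  \int[P]_(x in gasket) (w (F q j x))%:E = \int[nu]_(x in cell1 j) (w x)%:E.
Proof.
move=> PE iw; have mw := measurable_int _ iw.
have GSG : Finv q j @^-1` gasket = cell1 j by rewrite -image_F.
(* The image measure theorem asks for measurability on the whole plane. *)
pose psi : borel_plane R -> \bar R := (EFin \o w \o F q j) \_ gasket.
have mpsi : measurable_fun setT psi.
  apply/(measurable_restrictT _ mSG).
  apply: (measurable_comp (F := cell1 j) (f := EFin \o w)) => //.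
  exact: measurable_funTS (mF j).
have psiE x : x \in gasket -> psi x = (w (F q j x))%:E.
  by move=> xS; rewrite /psi patchE xS.
have psiGE x : x \in Finv q j @^-1` gasket -> (psi \o Finv q j) x = (w x)%:E.
  by move=> xS; rewrite /= psiE ?FinvK // inE; move: xS; rewrite inE.
have ipsi : nu.-integrable (Finv q j @^-1` gasket) (psi \o Finv q j).
  rewrite GSG; apply: eq_integrable iw => // x xS.
  by rewrite psiGE // GSG.
pose Gj : borel_plane R -> borel_plane R := Finv q j.
pose push : {measure set (borel_plane R) -> \bar R} := pushforward nu Gj.
pose m0 := push (mG j).
have Pm0 (A : set (borel_plane R)) : measurable A -> A `<=` gasket -> P A = m0 A.
  move=> mA AS; rewrite PE /m0 /push /= /pushforward; congr (nu _).
  by apply/setIidl => x /AS Sx; exists (Finv q j x) => //; exact: FinvK.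
have eqint (g : borel_plane R -> \bar R) :
    \int[P]_(x in gasket) g x = \int[m0]_(x in gasket) g x.
  exact: eq_measure_integral.
have Ppsi : P.-integrable gasket psi.
  have /integrableP[_ +] := integrable_pushforward (mG j) mpsi ipsi mSG.
  move=> H; apply/integrableP; split; first exact: measurable_funTS.
  by rewrite eqint.
split.
  by apply: eq_integrable Ppsi => //.
rewrite -(eq_integral _ _ psiE) eqint.
rewrite [LHS](integral_pushforward (mG j) mpsi ipsi mSG) GSG.
by apply: eq_integral => x xS; rewrite psiGE // GSG.
Qed.

Lemma gasket_fun_bounded (v : R * R -> R) : {within SG, continuous v} ->
  [bounded v x | x in gasket].
Proof.
move=> cv; case: (hSG) => _ cSG _.
have [M [Mr MB]] := compact_bounded (continuous_compact cv cSG).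
exists M; split => // y My x Sx; apply: (MB y My).
by exists x.
Qed.

Lemma integrable_gasketM (m : {measure set (borel_plane R) -> \bar R})
    (f v : R * R -> R) : {within SG, continuous v} ->
  m.-integrable gasket (EFin \o f) -> m.-integrable gasket (fun x => (f x * v x)%:E).
Proof.
move=> cv intf.
have mv := within_continuous_measurable_plane (closed_gasket hSG) cv.
exact: (integrableMl mSG intf mv (gasket_fun_bounded cv)).
Qed.

Lemma integral_transplant j (f v : R * R -> R) :
  \int[nu]_(x in gasket) (f x * transplant q SG j v x)%:E =
  \int[nu]_(x in cell1 j) (f x * v (Finv q j x))%:E.
Proof.
have E : cell1 j = gasket `&` cell1 j.
  by apply/seteqP; split=> [x xj|x []//]; split => //; case: xj => y /(gasketF hSG j) + <-.
rewrite [in RHS]E integral_mkcondr; apply: eq_integral => x _.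
rewrite patchE /transplant; case: ifPn => // _.
by rewrite mulr0.
Qed.

Lemma finite_energy_transplant j (v : R * R -> R) : (forall i, v (q i) = 0%R) ->
  finite_energy q SG v -> finite_energy q SG (transplant q SG j v).
Proof.
move=> v0 [cv ev]; split; first exact: within_continuous_transplant.
by apply: cvgn_energy_transplant ev; exact: transplantP.
Qed.

(** A test function for [u \o F_j], copied into the cell [F_j SG], is a test function
    for [u]. This multiplies energies by [5/3], and moving the integral over the
    cell back to [SG] multiplies the integrand by the density [5/3 Q_j]. *)
Lemma laplacian_cell_exists j (u f : R * R -> R) :
  is_energy_laplacian q SG nu u f -> exists2 g : R * R -> R,
    is_energy_laplacian q SG nu (u \o F q j) g &
    {ae nu, forall x, (g x)%:E = Q nu_ j x * (f (F q j x))%:E}.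
Proof.
move=> [[cu eu] intf lap].
have [P PE [Pnu PQ]] := cell_image_density j.
pose D : borel_plane R -> \bar R := Radon_Nikodym (charge_of_finite_measure P) nu.
have Dfin x : D x \is a fin_num by exact: Radon_Nikodym_fin_num.
have cellS : cell1 j `<=` gasket by move=> _ [x Sx <-]; exact: gasketF.
have intfF : P.-integrable gasket (EFin \o f \o F q j).
  apply: (cell_change_of_variables PE _).1.
  exact: integrableS intf.
(* [3/5] compensates the factor [5/3] of the energy. *)
exists (fun x => 3 / 5 * fine (D x) * f (F q j x))%R; last first.
  apply: filterS PQ => x /(_ I) Dx; rewrite EFinM [(3 / 5 * _)%:E]EFinM fineK // [D x]Dx muleA.
  by rewrite -EFinM (_ : 3 / 5 * (5 / 3) = 1)%R ?mul1e //; field.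
split.
- split; first exact: within_continuous_F.
  exact: cvgn_energy_F.
- have := integrableZl mSG (3 / 5) (integrable_Radon_Nikodym Pnu mSG intfF).
  apply: eq_integrable => // x _ /=.
  rewrite -/(D x) -(fineK (Dfin x)) -!EFinM /=.
  by congr EFin; ring.
- move=> v [cv ev] v0.
  have ftv := finite_energy_transplant j v0 (conj cv ev).
  have tv := transplantP hq hSG j v0.
  have := lap _ ftv (fun i => transplant_corner hq hSG j i v0).
  rewrite (energy_transplant tv eu ev) integral_transplant.
  have intw : nu.-integrable (cell1 j) (EFin \o (fun x => f x * v (Finv q j x))%R).
    have := integrable_gasketM ftv.1 intf.
    move/(integrableS mSG (mcell1 j) cellS).
    apply: eq_integrable => // x /set_mem[y Sy <-] /=.
    by rewrite transplant_in // FK.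
  have [intP <-] := cell_change_of_variables PE intw.
  rewrite -(Radon_Nikodym_change_of_variables Pnu mSG intP) => E.
  have -> : (- energy q (u \o F q j) v)%R =
      (3 / 5 * - (5 / 3 * energy q (u \o F q j) v))%R by field.
  rewrite EFinM E -integralZl //; last exact: integrable_Radon_Nikodym.
  apply: eq_integral => x _; rewrite /= FK -/(D x) -(fineK (Dfin x)) -!EFinM /=.
  by congr EFin; ring.
Qed.

End cell_laplacian.

(** * Uniqueness of the Laplacian *)

Section uniqueness.
Local Open Scope ereal_scope.
Context {R : realType} (q : 'I_3 -> R * R) (SG : set (R * R)).
Context (h : 'I_3 -> R * R -> R).
Context (nu_ : 'I_3 -> {finite_measure set (borel_plane R) -> \bar R}).
Hypotheses (hq : equilateral q) (hSG : sierpinski_gasket q SG)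
  (hharm : forall i, sg_harmonic q SG (h i))
  (hbd : forall i j, h i (q j) = (i == j)%:R)
  (hnu : forall i, energy_measure q SG (h i) (nu_ i)).
Local Notation nu := (kusuoka nu_).
Local Notation gasket := (SG : set (borel_plane R)).
Local Notation cell w := (Fw q w @` SG : set (borel_plane R)).

Let mSG : measurable gasket. Proof. exact: measurable_gasket hSG. Qed.

Let fh := flat_harmonic hharm.

Let mG j : measurable_fun setT (Finv q j : borel_plane R -> borel_plane R).
Proof. by apply: continuous_measurable_plane; exact: continuous_Finv. Qed.

Lemma within_continuous_sum (g : 'I_3 -> R * R -> R) :
  (forall l, {within SG, continuous (g l)}) ->
  {within SG, continuous (fun x => \sum_(l < 3) g l x)%R}.
Proof.
move=> cg; rewrite (_ : (fun x => _) = (g c0 \+ g c1 \+ g c2)%R); last first.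
  by apply/funext => x; rewrite sum3E.
by move=> x; apply: cvgD; [apply: cvgD|]; exact: cg.
Qed.

Lemma within_continuous_scale (c : R) (g : R * R -> R) :
  {within SG, continuous g} -> {within SG, continuous (fun x => g x * c)%R}.
Proof. by move=> cg x; apply: cvgM; [exact: cg|exact: cvg_cst]. Qed.

Lemma within_continuous_exp n (g : R * R -> R) :
  {within SG, continuous g} -> {within SG, continuous (fun x => g x ^+ n)%R}.
Proof.
move=> cg; elim: n => [|n IH].
  by rewrite (_ : (fun x => _) = cst 1%R) //; move=> x; exact: cvg_cst.
rewrite (_ : (fun x => _) = (g \* (fun x => g x ^+ n))%R); last first.
  by apply/funext => x; rewrite exprS.
by move=> x; apply: cvgM; [exact: cg|exact: IH].
Qed.

Lemma harmonic_ge0 l x : SG x -> (0 <= h l x)%R.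
Proof.
move=> Sx; apply: (gasket_ge0 hSG (hharm l).1 _ Sx) => w i.
by have /andP[] := harmonic_basis01 fh hbd l w i.
Qed.

Lemma harmonic_sum1 x : SG x -> (\sum_(l < 3) h l x = 1)%R.
Proof.
apply: (gasket_eq hSG (f := fun x => (\sum_(l < 3) h l x)%R) (g := cst 1%R)).
- by apply: within_continuous_sum => l; exact: (hharm l).1.
- by apply: continuous_subspaceT => y; exact: cvg_cst.
- by move=> w i; exact: flat_sum1.
Qed.

Lemma harmonic_le1 l x : SG x -> (h l x <= 1)%R.
Proof.
move=> Sx; rewrite -(harmonic_sum1 Sx) (bigD1 l) //= lerDl sumr_ge0 // => i _.
exact: harmonic_ge0.
Qed.

Lemma harmonic_F i k x : SG x ->
  (h i (F q k x) = \sum_(l < 3) h l x * harmonic_step (h i \o q) k l)%R.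
Proof.
apply: (gasket_eq hSG (f := h i \o F q k)
  (g := fun x => (\sum_(l < 3) h l x * harmonic_step (h i \o q) k l)%R)).
- exact: within_continuous_F (hharm i).1.
- apply: within_continuous_sum => l; apply: within_continuous_scale.
  exact: (hharm l).1.
- move=> w p; have := flat_expand w p fh hbd (flat_F k (fh i)); rewrite /= => ->.
  by apply: eq_bigr => l _; rewrite mulrC (flat_step k l (fh i)).
Qed.

(** As a set this is the corner [q_i]; it is introduced through [h_i] because the
    functions [exhaust] are. *)
Definition peak i : set (borel_plane R) := [set x | SG x /\ h i x = 1%R].

Lemma measurable_peak i : measurable (peak i).
Proof.
have mh := within_continuous_measurable_plane (closed_gasket hSG) (hharm i).1.
exact: (mh mSG [set 1%R] (measurable_set1 _)).
Qed.

(** If [h_i = 1] at [F_k y] then [h_i (F_k y)], a convex combination of the values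
    [h_i (F_k q_l)], uses only those equal to [1]; this forces [k = i] and
    [h_i y = 1]. *)
Lemma peak_F i : peak i `<=` F q i @` peak i.
Proof.
move=> x [Sx hx1]; have [k [y Sy yx]] := gasketP hSG Sx.
have H0 l := harmonic_ge0 l Sy.
have := harmonic_sum1 Sy; rewrite sum3E => H1.
move: hx1; rewrite -yx (harmonic_F i k Sy) sum3E /harmonic_step /= !sum3E !hbd => hx1.
have [ik|ik] := eqVneq i k.
  rewrite -{k}ik in yx hx1 *; exists y => //; split => //.
  move: H1 hx1 (H0 c0) (H0 c1) (H0 c2); elim/ord3_ind: i {yx} => /=; lra.
exfalso; move: H1 hx1 (H0 c0) (H0 c1) (H0 c2) ik.
elim/ord3_ind: i; elim/ord3_ind: k {yx} => //=; lra.
Qed.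

Lemma measurable_image_F j (A : set (borel_plane R)) : measurable A ->
  measurable (F q j @` A : set (borel_plane R)).
Proof. by move=> mA; rewrite image_F -[X in measurable X]setTI; exact: mG. Qed.

Lemma measurable_image_Fw w (A : set (borel_plane R)) : measurable A ->
  measurable (Fw q w @` A : set (borel_plane R)).
Proof.
move=> mA; elim: w => [|k w IH]; first by rewrite image_id.
by rewrite image_Fw_cons; exact: measurable_image_F.
Qed.

(** [13/15 = 1/15 + 4/5], since [nu_ j] is at most [nu]. *)
Lemma kusuoka_image_le j (A : set (borel_plane R)) : measurable A -> A `<=` gasket ->
  nu (F q j @` A : set (borel_plane R)) <= (13 / 15)%:E * nu A.
Proof.
move=> mA AS.
have -> : nu (F q j @` A : set (borel_plane R)) =
    (1 / 15)%:E * nu A + (4 / 5)%:E * nu_ j A.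
  have -> : F q j @` A = Finv q j @^-1` A `&` F q j @` SG.
    rewrite [LHS]image_F; apply/esym/setIidl => x /AS Sx.
    by exists (Finv q j x) => //; exact: FinvK.
  exact: (kusuoka_selfsimilar hSG hharm hbd hnu j mA).
have le : nu_ j A <= nu A.
  by rewrite kusuokaE (bigD1 j) //= leeDl // sume_ge0.
have : nu A \is a fin_num by exact: fin_num_measure.
have : nu_ j A \is a fin_num by exact: fin_num_measure.
move: le; move: (nu A) (nu_ j A) => [a| |] [b| |] //.
rewrite -!EFinM -EFinD !lee_fin => ba _ _; lra.
Qed.

(** [peak i] lies in its image under [F_i], whose measure is smaller by the factor
    [13/15]. *)
Lemma peak_null i : nu (peak i) = 0.
Proof.
have mp := measurable_peak i.
have le : nu (peak i) <= (13 / 15)%:E * nu (peak i).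
  apply: (@le_trans _ _ (nu (F q i @` peak i : set (borel_plane R)))).
    apply: le_measure; rewrite ?inE //; last exact: peak_F.
    exact: measurable_image_F.
  by apply: kusuoka_image_le => // x [].
have : 0 <= nu (peak i) by exact: measure_ge0.
have : nu (peak i) \is a fin_num by exact: fin_num_measure.
move: le; move: (nu (peak i)) => [a| |] //; rewrite -EFinM !lee_fin => ? _ ?.
by congr EFin; lra.
Qed.

Definition peaks := peak c0 `|` peak c1 `|` peak c2.

Lemma measurable_peaks : measurable peaks.
Proof. by apply: measurableU; [apply: measurableU|]; exact: measurable_peak. Qed.

Lemma peaks_null : nu peaks = 0.
Proof.
have mp := measurable_peak.
apply/eqP; rewrite eq_le measure_ge0 andbT.
apply: le_trans (measureU2 nu (measurableU _ _ (mp c0) (mp c1)) (mp c2)) _.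
have p0 i : nu (peak i) = 0 := peak_null i.
rewrite [X in _ + X]p0 adde0.
apply: le_trans (measureU2 nu (mp c0) (mp c1)) _.
by rewrite [X in _ + X]p0 [X in X + _]p0 adde0.
Qed.

Lemma image_null w (A : set (borel_plane R)) : measurable A -> A `<=` gasket ->
  nu A = 0 -> nu (Fw q w @` A : set (borel_plane R)) = 0.
Proof.
move=> mA AS A0; elim: w => [|k w IH]; first by rewrite image_id.
apply/eqP; rewrite eq_le measure_ge0 andbT image_Fw_cons.
apply: le_trans (kusuoka_image_le k _ _) _.
- exact: measurable_image_Fw.
- by move=> _ [x /AS Sx <-]; exact: gasketFw.
- by have -> : nu (Fw q w @` A) = 0 by []; rewrite mule0.
Qed.

(** ** Test functions concentrated on a cell *)

Definition cell_exhaust w n : R * R -> R :=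
  foldr (fun j v => transplant q SG j v) (exhaust h n) w.

Lemma cell_exhaust_test w n : finite_energy q SG (cell_exhaust w n) /\
  (forall i, cell_exhaust w n (q i) = 0%R).
Proof.
elim: w => [|k w [fe v0]]; last first.
  split=> [|i]; first exact: finite_energy_transplant.
  exact: transplant_corner.
split=> [|i]; last exact: exhaust_corner.
split; last exact: cvgn_energy_exhaust.
rewrite (_ : cell_exhaust [::] n = (cst 1 \- (fun x => \sum_(l < 3) h l x ^+ n.+1))%R) //.
move=> x; apply: cvgB; first exact: cvg_cst.
apply: within_continuous_sum => l; apply: within_continuous_exp.
exact: (hharm l).1.
Qed.

Lemma cell_exhaust_in w n x : SG x -> cell_exhaust w n (Fw q w x) = exhaust h n x.
Proof.
move=> Sx; elim: w => [//|k w IH].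
by rewrite /= transplant_in //; exact: gasketFw.
Qed.

Lemma cell_exhaust_out w n x : SG x -> ~ cell w x -> cell_exhaust w n x = 0%R.
Proof.
elim: w x => [|k w IH] x Sx nwx; first by case: nwx; exists x.
have [l [y Sy yx]] := gasketP hSG Sx.
have [_ v0] := cell_exhaust_test w n.
rewrite -yx; have [lk|lk] := eqVneq l k; last exact: transplant_out.
rewrite lk /= transplant_in // IH // => -[z Sz zy].
by apply: nwx; exists z => //; rewrite Fw_cons zy -lk.
Qed.

Lemma exhaust01 n x : SG x -> (0 <= exhaust h n x <= 1)%R.
Proof.
move=> Sx; rewrite /exhaust subr_ge0 lerBlDr lerDl.
apply/andP; split; last first.
  by apply: sumr_ge0 => l _; rewrite exprn_ge0 // harmonic_ge0.
rewrite -(harmonic_sum1 Sx) ler_sum // => l _.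
by rewrite exprS ler_piMr ?harmonic_ge0 // exprn_ile1 ?harmonic_ge0 ?harmonic_le1.
Qed.

Lemma exhaust_cvg x : SG x -> (forall i, ~ peak i x) ->
  (fun n => exhaust h n x) @ \oo --> (1%R : R).
Proof.
move=> Sx np.
have c l : (fun n => h l x ^+ n.+1)%R @ \oo --> (0%R : R).
  rewrite (cvg_shiftS (fun n => h l x ^+ n)%R); apply: cvg_expr.
  rewrite ger0_norm ?harmonic_ge0 // lt_neqAle harmonic_le1 // andbT.
  by apply/eqP => h1; apply: (np l).
rewrite (_ : (fun n => _) = (fun n => 1 - (h c0 x ^+ n.+1 + h c1 x ^+ n.+1 + h c2 x ^+ n.+1))%R).
  rewrite [X in _ --> X](_ : _ = 1 - (0 + 0 + 0))%R; last by rewrite !addr0 subr0.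
  by apply: cvgB; [exact: cvg_cst|apply: cvgD => //; exact: cvgD].
by apply/funext => n; rewrite /exhaust sum3E.
Qed.

(** The functions [cell_exhaust w n] are bounded by [1] and tend to the indicator of
    the cell off the null set [F_w peaks]. *)
Lemma annihilator_cell (d : R * R -> R) w : nu.-integrable gasket (EFin \o d) ->
  (forall v, finite_energy q SG v -> (forall i, v (q i) = 0%R) ->
     \int[nu]_(x in gasket) (d x * v x)%:E = 0) ->
  \int[nu]_(x in cell w) (d x)%:E = 0.
Proof.
move=> intd ann.
have mcell : measurable (cell w) by exact: (measurable_cell hSG w).
have md := measurable_int _ intd.
have cellE : cell w = gasket `&` cell w.
  apply/seteqP; split=> [x xw|x []//]; split => //.
  by case: xw => y Sy <-; exact: gasketFw.
rewrite [X in \int[_]_(x in X) _]cellE integral_mkcondr.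
pose f_ n : borel_plane R -> \bar R := fun x => (d x * cell_exhaust w n x)%:E.
pose f : borel_plane R -> \bar R := (fun x => (d x)%:E) \_ (cell w).
have mf : measurable_fun gasket f.
  apply/measurable_restrict => //; rewrite -cellE; apply: measurable_funS md => //.
  by rewrite cellE => x [].
have intf_ n : nu.-integrable gasket (f_ n).
  by apply: (integrable_gasketM hSG) => //; exact: (cell_exhaust_test w n).1.1.
have cv : {ae nu, forall x, gasket x -> f_ ^~ x @ \oo --> f x}.
  exists (Fw q w @` peaks); split.
  - exact: (measurable_image_Fw w measurable_peaks).
  - by apply: image_null; [exact: measurable_peaks|move=> x [[[]|[]]|[]]|exact: peaks_null].
  - move=> x /= nx; apply: contrapT => xN; apply: nx => Sx.
    have [xw|xw] := pselect (cell w x); last first.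
      rewrite /f patchE memNset // (_ : f_ ^~ x = cst 0); first exact: cvg_cst.
      by apply/funext => n; rewrite /f_ cell_exhaust_out // mulr0.
    rewrite /f patchE mem_set //; case: (xw) => y Sy yx.
    apply: cvg_EFin; first exact: nearW.
    rewrite -[X in _ --> X]mulr1; apply: cvgM; first exact: cvg_cst.
    rewrite -yx; under eq_fun do rewrite cell_exhaust_in //.
    apply: exhaust_cvg => // i py; apply: xN; exists y => //; move: py.
    by elim/ord3_ind: i => ?; [left; left|left; right|right].
have dom : {ae nu, forall x, forall n, gasket x -> `|f_ n x| <= (abse \o EFin \o d) x}.
  apply: aeW => x n Sx; rewrite /f_ /= lee_fin normrM ler_piMr //.
  have [[y Sy yx]|xw] := pselect (cell w x).
    rewrite -yx cell_exhaust_in //; have /andP[b0 b1] := exhaust01 n Sy.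
    by rewrite ger0_norm.
  by rewrite cell_exhaust_out // normr0.
have [_ _] := dominated_convergence mSG (fun n => measurable_int _ (intf_ n)) mf cv
  (integrable_abse intd) dom.
move/cvg_lim => <- //.
rewrite (_ : (fun n => _) = cst 0) ?lim_cst //; apply/funext => n.
exact: ann (cell_exhaust_test w n).1 (cell_exhaust_test w n).2.
Qed.

(** The signed measure with density [d] vanishes on cells, so its positive and
    negative parts agree on cells and hence coincide. *)
Lemma annihilator_ae0 (d : R * R -> R) : nu.-integrable gasket (EFin \o d) ->
  (forall v, finite_energy q SG v -> (forall i, v (q i) = 0%R) ->
     \int[nu]_(x in gasket) (d x * v x)%:E = 0) ->
  {ae nu, forall x, SG x -> d x = 0%R}.
Proof.
move=> intd ann.
pose e : borel_plane R -> \bar R := (EFin \o d) \_ gasket.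
have inte : nu.-integrable setT e by exact: ((integrable_mkcond _ mSG).1 intd).
have me := measurable_int _ inte.
pose phi := induced_charge inte.
have phinu : phi `<< nu.
  apply/null_content_dominatesP => A mA nuA0.
  by rewrite /phi /induced_charge null_set_integral //; exact: measurable_funTS.
have [Pos [Neg PN]] := Hahn_decomposition phi.
have pnu := jordan_pos_dominates PN phinu.
have nnu := jordan_neg_dominates PN phinu.
have mcell w : measurable (cell w) by exact: (measurable_cell hSG w).
have phiE A : measurable A -> phi A = jordan_pos PN A - jordan_neg PN A.
  by move=> mA; rewrite [LHS](jordan_decomp PN mA) /cadd /= cscaleN1.
have phi_cell w : phi (cell w) = 0.
  rewrite -(annihilator_cell w intd ann) /phi /induced_charge.
  apply: eq_integral => x /set_mem[y Sy yx]; rewrite /e patchE mem_set //.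
  by rewrite -yx; exact: gasketFw.
have dom0 (m : {finite_measure set (borel_plane R) -> \bar R}) (A : set (borel_plane R)) :
    m `<< nu -> measurable A -> nu A = 0 -> m A = 0.
  by move=> /null_content_dominatesP mnu mA A0; exact: mnu.
have mSGC : measurable (~` gasket) by exact: measurableC.
have posneg A : measurable A -> jordan_pos PN A = jordan_neg PN A.
  apply: (cell_measure_unique hSG (m1 := jordan_pos PN) (m2 := jordan_neg PN)).
  - by apply: dom0 => //; exact: kusuoka_outside.
  - by apply: dom0 => //; exact: kusuoka_outside.
  - by move=> m w w' ww'; apply: dom0 => //; [exact: measurableI|exact: (kusuoka_overlap hSG hharm)].
  - by move=> m w w' ww'; apply: dom0 => //; [exact: measurableI|exact: (kusuoka_overlap hSG hharm)].
  move=> w; have := phiE _ (mcell w); rewrite phi_cell => /esym/eqP.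
  rewrite sube_eq ?add0e ?fin_num_adde_defl ?fin_num_measure //.
  by move/eqP.
have phi0 A : measurable A -> phi A = 0.
  move=> mA; rewrite phiE // posneg //.
  by rewrite subee // fin_num_measure.
have : ae_eq nu setT e (cst 0).
  apply: integral_ae_eq => // A _ mA.
  by rewrite integral0; exact: phi0.
apply: filterS => x /(_ I) + Sx; rewrite /e patchE mem_set //.
by case.
Qed.

Lemma laplacian_unique (u g1 g2 : R * R -> R) :
  is_energy_laplacian q SG nu u g1 -> is_energy_laplacian q SG nu u g2 ->
  {ae nu, forall x, SG x -> g1 x = g2 x}.
Proof.
move=> [_ i1 lap1] [_ i2 lap2].
have : {ae nu, forall x, SG x -> (g1 x - g2 x = 0)%R}.
  apply: annihilator_ae0; first exact: (integrableB mSG i1 i2).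
  move=> v fv v0.
  have j1 := integrable_gasketM hSG fv.1 i1; have j2 := integrable_gasketM hSG fv.1 i2.
  under eq_integral do rewrite mulrBl EFinB.
  rewrite integralB // -(lap1 v fv v0) -(lap2 v fv v0) subee //.
apply: (@filterS (borel_plane R) _ (ae_filter_ringOfSetsType nu)) => x H Sx.
by apply/eqP; rewrite -subr_eq0 H.
Qed.

End uniqueness.

Theorem theorem2p3 (R : realType) (q : 'I_3 -> R * R) (SG : set (R * R))
  (h : 'I_3 -> R * R -> R)
  (nu_ : 'I_3 -> {finite_measure set (borel_plane R) -> \bar R})
  (hq : equilateral q) (hSG : sierpinski_gasket q SG)
  (hharm : forall i, sg_harmonic q SG (h i))
  (hbd : forall i j, h i (q j) = (i == j)%:R)
  (hnu : forall i, energy_measure q SG (h i) (nu_ i))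
  (u f : R * R -> R)
  (hu : is_energy_laplacian q SG (kusuoka nu_) u f) (j : 'I_3) :
  (exists g : R * R -> R,
     is_energy_laplacian q SG (kusuoka nu_) (u \o F q j) g) /\
  (forall g : R * R -> R,
     is_energy_laplacian q SG (kusuoka nu_) (u \o F q j) g ->
     {ae kusuoka nu_, forall x, SG x ->
        (g x)%:E = (Q nu_ j x * (f (F q j x))%:E)%E}).
Proof.
have [g0 lap0 g0E] := laplacian_cell_exists hq hSG hharm hbd hnu j hu.
split; first by exists g0.
move=> g lapg; have gg0 := laplacian_unique hq hSG hharm hbd hnu lapg lap0.
apply: (@filterS2 (borel_plane R) _ (ae_filter_ringOfSetsType (kusuoka nu_)) _ _ _ _
  gg0 g0E) => x gx g0x Sx.
by rewrite gx.
Qed.
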